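(* Let $k$ be a field and $X=\mathbb A^n/\mu_M(d_1,\dots,d_n)$ a quotient singularity over $k$, where $\operatorname{char} k$ does not divide $M$ and $\gcd(d_1,\dots,\widehat{d_i},\dots,d_n,M)=1$ for every $i$. Let $D_i=(x_i=0)/\mu_M(d_1,\dots,\widehat{d_i},\dots,d_n)\subset X$. Let $l$ be an integer and let $0\le b_i<c_i$ ($i=1,\dots,n$) be integers such that $\gcd(b_i,c_i)=1$ for every $i$. The following are equivalent. (1) $Y:=Y(\mathcal O_X(l),\sum \tfrac{b_i}{c_i}D_i)$ is smooth. (2) (a) $\gcd(c_i,c_j)=1$ for every $i\ne j$, and (b) $\mathcal O_X(l\prod_i c_i)\bigl(\sum_i(\prod_{j\ne i}c_j)b_iD_i\bigr)$ generates $\operatorname{Cl}(X)$. (3) (a) $\gcd(c_i,c_j)=1$ for every $i\neq j$, and (b) $(\prod_i c_i)\,c_1(Y/X)$ is relatively prime to $M$.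
   Context: $\mu_M$ is the group scheme of $M$th roots of unity. $\mathbb A^n/\mu_M(d_1,\dots,d_n)$ denotes the quotient of $\mathbb A^n=\operatorname{Spec}k[x_1,\dots,x_n]$ by the $\mu_M$-action $x_i\mapsto\lambda^{d_i}x_i$. For $j\in\mathbb Z$, $\mathcal O_X(j)$ denotes the $\mathcal O_X$-module spanned by the monomials $\prod x_i^{v_i}$ with $v_i\ge0$ and $\sum d_iv_i\equiv j \bmod M$; it is a rank 1 reflexive sheaf. $\operatorname{Cl}(X)$ is the group of rank 1 reflexive sheaves (Weil divisors modulo linear equivalence). The map $j\mapsto\mathcal O_X(j)$ gives an isomorphism $\mathbb Z/M\cong\operatorname{Cl}(X)$, and $\mathcal O_X(D_i)\cong\mathcal O_X(d_i)$. For a rank 1 reflexive sheaf $L$, $L^{[j]}:=(L^{\otimes j})^{**}$ and $L^{[j]}(D):=(L^{\otimes j}\otimes\mathcal O_X(D))^{**}$ for an integral Weil divisor $D$; for rational numbers $0\le s_i<1$ (terms with $s_i=0$ may be dropped), $$Y(L,\textstyle\sum s_iD_i):=\operatorname{Spec}_X\sum_{j\in\mathbb Z}L^{[j]}\bigl(\sum_i\lfloor js_i\rfloor D_i\bigr),$$ with multiplication given by the tensor product. The Chern class of $Y=Y(L,\sum s_iD_i)$ is formally $c_1(Y/X)=c_1(L)+\sum s_i[D_i]$. The multiple $(\prod_i c_i)c_1(Y/X)$ is the well defined class in $\operatorname{Cl}(X)$ of $L^{[\prod c_i]}\bigl(\sum_i(\prod_{j\ne i}c_j)b_iD_i\bigr)$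 (here $L=\mathcal O_X(l)$, $s_i=b_i/c_i$), regarded as an element of $\mathbb Z/M$ via the isomorphism $\operatorname{Cl}(X)\cong\mathbb Z/M$ above; thus it is the residue of $l\prod_ic_i+\sum_i(\prod_{j\ne i}c_j)b_id_i$ modulo $M$. *)

(* Defs.v *)
From HB Require Import structures.
From mathcomp Require Import all_boot all_order all_algebra.
From mathcomp Require Import boolp.
From mathcomp Require Import fraction mpoly.

Set Implicit Arguments.
Unset Strict Implicit.
Unset Printing Implicit Defensive.

Import Order.TTheory GRing.Theory Num.Theory.
Local Open Scope ring_scope.

(* All schemes below are affine: X = Spec A with A a domain contained in a
   field F, and sheaves of rank 1 on X are A-submodules of F. *)

(* Smoothness of Spec B -> Spec k: (formally smooth) + (finite type). Over a
   field, finite type and finite presentation coincide. *)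

Definition finite_type (k : fieldType) (B : comNzRingType)
    (phi : {rmorphism k -> B}) : Prop :=
  exists (m : nat) (g : 'I_m -> B),
    forall y : B, exists p : {mpoly k[m]}, y = mmap phi g p.

(* C' is the quotient of C by the square-zero ideal ker pi. *)
Definition formally_smooth (k : fieldType) (B : comNzRingType)
    (phi : {rmorphism k -> B}) : Prop :=
  forall (C C' : comPzRingType) (pi : {rmorphism C -> C'})
         (iota : {rmorphism k -> C}) (u : {rmorphism B -> C'}),
    (forall y, exists x, pi x = y) ->
    (forall x y, pi x = 0 -> pi y = 0 -> x * y = 0) ->
    (forall a, u (phi a) = pi (iota a)) ->
    exists v : {rmorphism B -> C},
      (forall y, pi (v y) = u y) /\ (forall a, v (phi a) = iota a).

Definition smooth (k : fieldType) (B : comNzRingType)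
    (phi : {rmorphism k -> B}) : Prop :=
  finite_type phi /\ formally_smooth phi.

Definition aspan (V : zmodType) (S : V -> Prop) (y : V) : Prop :=
  exists s : seq V, (forall z, z \in s -> S z) /\ y = \sum_(z <- s) z.

Section RankOneModules.

Variables (F : fieldType) (A : F -> Prop).

Implicit Types (N P : F -> Prop) (f g h : F).

(* If N <> 0 lies in a line g * Frac A, every A-linear map N -> A is the
   multiplication by a unique element of F, so this is Hom_A(N, A). *)
Definition mdual N f : Prop := forall g, N g -> A (f * g).

Definition hull N : F -> Prop := mdual (mdual N).

(* The tensor product modulo torsion; torsion is invisible to duals. *)
Definition mmul N P : F -> Prop :=
  aspan (fun f => exists g h, [/\ N g, P h & f = g * h]).

(* The tensor power modulo torsion, a negative power being a power of the
   dual. *)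
Definition mpow N (j : int) : F -> Prop :=
  match j with
  | Posz m => iter m (mmul N) A
  | Negz m => iter m.+1 (mmul (mdual N)) A
  end.

Definition rpow N (j : int) : F -> Prop := hull (mpow N j).

(* The condition that the dual is nonzero says that N is a fractional ideal
   (up to the choice of the line); it is what coherence of N amounts to. *)
Definition rank1_reflexive N : Prop :=
  [/\ exists g, [/\ g != 0, N g &
        forall f, N f -> exists a b, [/\ A a, A b, b != 0 & b * f = a * g]],
      exists h, h != 0 /\ mdual N h
    & forall f, N f <-> hull N f].

Definition misom N P : Prop :=
  exists phi : F -> F,
    [/\ forall f g, N f -> N g -> phi (f + g) = phi f + phi g,
        forall a f, A a -> N f -> phi (a * f) = a * phi f,
        forall f, N f -> phi f = 0 -> f = 0,
        forall f, N f -> P (phi f)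
      & forall g, P g -> exists f, N f /\ phi f = g].

(* Cl(X) is the group of isomorphism classes of rank 1 reflexive sheaves, the
   j-th power of the class of N being the class of rpow N j. Every such sheaf
   is isomorphic to a submodule of Frac A, so submodules of F suffice. *)
Definition generates_Cl N : Prop :=
  rank1_reflexive N /\
  forall P, rank1_reflexive P -> exists j : int, misom P (rpow N j).

End RankOneModules.

Section Aspan.

Lemma aspan0 (V : zmodType) (S : V -> Prop) : aspan S 0.
Proof. by exists [::]; rewrite big_nil. Qed.

Lemma aspan_id (V : zmodType) (S : V -> Prop) x : S x -> aspan S x.
Proof.
move=> Sx; exists [:: x]; rewrite big_seq1; split=> // z.
by rewrite inE => /eqP->.
Qed.

Lemma aspanD (V : zmodType) (S : V -> Prop) x y :
  aspan S x -> aspan S y -> aspan S (x + y).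
Proof.
move=> [s [Ss ->]] [t [St ->]]; exists (s ++ t); rewrite big_cat; split=> // z.
by rewrite mem_cat => /orP[/Ss|/St].
Qed.

Lemma aspan_ind (V : zmodType) (S Q : V -> Prop) :
    Q 0 -> (forall x y, Q x -> Q y -> Q (x + y)) -> (forall x, S x -> Q x) ->
  forall x, aspan S x -> Q x.
Proof.
move=> Q0 QD SQ x [s [Ss ->]]; elim: s Ss => [|z s IHs] Ss.
  by rewrite big_nil.
rewrite big_cons; apply: QD; first by apply/SQ/Ss; rewrite mem_head.
by apply: IHs => w ws; apply: Ss; rewrite inE ws orbT.
Qed.

Lemma aspanN (V : zmodType) (S : V -> Prop) x :
  (forall z, S z -> S (- z)) -> aspan S x -> aspan S (- x).
Proof.
move=> SN; move: x; apply: aspan_ind => [|x y hx hy|x Sx].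
- by rewrite oppr0; apply: aspan0.
- by rewrite opprD; apply: aspanD.
- exact/aspan_id/SN.
Qed.

Lemma aspanM (T : pzRingType) (S1 S2 S3 : T -> Prop) :
    (forall x y, S1 x -> S2 y -> aspan S3 (x * y)) ->
  forall x y, aspan S1 x -> aspan S2 y -> aspan S3 (x * y).
Proof.
move=> SM x y hx hy; move: x hx; apply: aspan_ind => [|x x' hx hx'|x Sx].
- by rewrite mul0r; apply: aspan0.
- by rewrite mulrDl; apply: aspanD.
move: y hy; apply: aspan_ind => [|y y' hy hy'|y Sy].
- by rewrite mulr0; apply: aspan0.
- by rewrite mulrDr; apply: aspanD.
- exact: SM.
Qed.

End Aspan.

Section RankOneModulesTheory.

Variables (F : fieldType) (A : F -> Prop).
Hypotheses (A1 : A 1) (AB : forall x y, A x -> A y -> A (x - y)).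
Hypothesis (AM : forall x y, A x -> A y -> A (x * y)).

Implicit Types (N P Q : F -> Prop).

Lemma subring0 : A 0. Proof. by rewrite -(subrr 1); apply: AB. Qed.

Lemma subringD x y : A x -> A y -> A (x + y).
Proof.
by move=> Ax Ay; rewrite -[y]opprK -(sub0r y); do 2!apply: AB=> //; apply: subring0.
Qed.

Lemma mdualS N P : (forall f, N f -> P f) ->
  forall f, mdual A P f -> mdual A N f.
Proof. by move=> NP f Pf g /NP /Pf. Qed.

Lemma hullS N P : (forall f, N f -> P f) -> forall f, hull A N f -> hull A P f.
Proof. by move=> NP; apply/mdualS/mdualS. Qed.

Lemma sub_hull N f : N f -> hull A N f.
Proof. by move=> Nf g /(_ f Nf); rewrite mulrC. Qed.

Lemma hull_idem N f : hull A (hull A N) f -> hull A N f.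
Proof. by apply: mdualS => g; apply: sub_hull. Qed.

Lemma mdualD N f g : mdual A N f -> mdual A N g -> mdual A N (f + g).
Proof.
by move=> Nf Ng h Nh; rewrite mulrDl; apply: subringD; [apply: Nf|apply: Ng].
Qed.

Lemma mdualN N f : mdual A N f -> mdual A N (- f).
Proof.
move=> Nf h Nh; rewrite mulNr -sub0r; apply: AB; first exact: subring0.
exact: Nf.
Qed.

Lemma mmulP N P f g : N f -> P g -> mmul N P (f * g).
Proof. by move=> Nf Pg; apply: aspan_id; exists f, g. Qed.

Lemma hullM N P f g : hull A N f -> hull A P g -> hull A (mmul N P) (f * g).
Proof.
move=> Nf Pg h NPh; rewrite -mulrA; apply: Nf => x Nx.
rewrite -mulrA; apply: Pg => y Py; rewrite -mulrA.
by apply: NPh; apply: mmulP.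
Qed.

Lemma mmulM N N' P P' Q Q' :
    (forall f g, N f -> P g -> Q (f * g)) ->
    (forall f g, N' f -> P' g -> Q' (f * g)) ->
  forall f g, mmul N N' f -> mmul P P' g -> mmul Q Q' (f * g).
Proof.
move=> hQ hQ' f g; apply: aspanM => x y [a [a' [Na Na' ->]]].
by move=> [b [b' [Pb Pb' ->]]]; rewrite mulrACA; apply: mmulP;
  [apply: hQ | apply: hQ'].
Qed.

Lemma mmul_stable N P : (forall a f, A a -> P f -> P (a * f)) ->
  forall a f, A a -> mmul N P f -> mmul N P (a * f).
Proof.
move=> PA a f Aa; move: f; apply: aspan_ind => [|x y hx hy|x [u [v [Nu Pv ->]]]].
- by rewrite mulr0; apply: aspan0.
- by rewrite mulrDr; apply: aspanD.
- by rewrite mulrCA; apply: mmulP => //; apply: PA.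
Qed.

Lemma iter_stable N m a f : A a -> iter m (mmul N) A f -> iter m (mmul N) A (a * f).
Proof. by elim: m a f => [|m IHm] a f; [apply: AM | apply: mmul_stable]. Qed.

Lemma iterD N m f g : iter m (mmul N) A f -> iter m (mmul N) A g ->
  iter m (mmul N) A (f + g).
Proof. by case: m => [|m]; [apply: subringD | apply: aspanD]. Qed.

Lemma iter0 N m : iter m (mmul N) A 0.
Proof. by case: m => [|m]; [apply: subring0 | apply: aspan0]. Qed.

Lemma iterM N m p f g : iter m (mmul N) A f -> iter p (mmul N) A g ->
  iter (m + p) (mmul N) A (f * g).
Proof.
elim: m f g => [|m IHm] f g; first exact: iter_stable.
rewrite addSn /= => hf hg; move: f hf; apply: aspan_ind => [|x y hx hy|x].
- by rewrite mul0r; apply: aspan0.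
- by rewrite mulrDl; apply: aspanD.
- by move=> [u [v [Nu hv ->]]]; rewrite -mulrA; apply: mmulP => //; apply: IHm.
Qed.

Lemma mpow_stable N j a f : A a -> mpow A N j f -> mpow A N j (a * f).
Proof. by case: j => m; apply: iter_stable. Qed.

Lemma iter_dual N m p f g :
    iter m (mmul N) A f -> iter p (mmul (mdual A N)) A g ->
  mpow A N (m%:Z - p%:Z) (f * g).
Proof.
elim: m p f g => [|m IHm] [|p] f g hf hg.
- by rewrite subrr; apply: AM.
- by rewrite sub0r; apply: iter_stable.
- by rewrite subr0 mulrC; apply: iter_stable.
have -> : m.+1%:Z - p.+1%:Z = m%:Z - p%:Z by rewrite !intS opprD addrACA subrr add0r.
have mpowD x y : mpow A N (m%:Z - p%:Z) x -> mpow A N (m%:Z - p%:Z) y ->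
    mpow A N (m%:Z - p%:Z) (x + y).
  by case: (_ - _) => q; apply: iterD.
have mpow0 : mpow A N (m%:Z - p%:Z) 0 by case: (_ - _) => q; apply: iter0.
move: f hf; apply: aspan_ind => [|x y hx hy|x [u [v [Nu hv ->]]]].
- by rewrite mul0r.
- by rewrite mulrDl; apply: mpowD.
move: g hg; apply: aspan_ind => [|x' y hx hy|x' [u' [v' [Nu' hv' ->]]]].
- by rewrite mulr0.
- by rewrite mulrDr; apply: mpowD.
rewrite mulrACA [u * u']mulrC; apply: mpow_stable; first exact: Nu'.
exact: IHm.
Qed.

Lemma mpowM N i j f g : mpow A N i f -> mpow A N j g -> mpow A N (i + j) (f * g).
Proof.
case: i j => i [] j hf hg.
- exact: iterM.
- by rewrite NegzE; apply: iter_dual.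
- by rewrite addrC mulrC NegzE; apply: iter_dual.
- by rewrite -[mpow _ _ _ _]/(iter (i + j).+2 _ _ _) -addSn -addnS; apply: iterM.
Qed.

Lemma mpow_anti N i j f : (forall f, N f -> A f) -> i <= j ->
  mpow A N j f -> mpow A N i f.
Proof.
move=> NA le_ij hf.
have [a ->] : exists a : nat, i = j - a%:Z.
  by exists `|j - i|%N; rewrite gez0_abs ?subr_ge0// opprB addrC subrK.
rewrite -[f]mulr1; apply: mpowM => //; case: a => [|a]; first exact: A1.
rewrite -NegzE /=; elim: a => [|a IHa].
  by rewrite -[1]mulr1; apply: mmulP => // g /NA; rewrite mul1r.
by rewrite -[1]mulr1; apply: mmulP => // g /NA; rewrite mul1r.
Qed.

End RankOneModulesTheory.

Local Notation "x %:F" := (@tofrac _ x) : ring_scope.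

Section QuotientSingularity.

Variables (k : fieldType) (n M : nat) (d : 'I_n -> int).

Local Notation R := {mpoly k[n]}.
Local Notation F := {fraction R}.
Local Notation E := {fraction {poly F}}.

(* The action x_i |-> lambda ^ d_i x_i as a map to R[lambda]; it becomes the
   coaction R -> R (x) k[mu_M] modulo lambda ^ M - 1, which is why the
   exponents d_i may be reduced modulo M. *)
Definition coaction : R -> {poly R} :=
  mmap (polyC \o @mpolyC n k)
       (fun i => ('X_i : R)%:P * 'X^`|(d i %% M)%Z|).

Definition mu_invariant (f : R) : Prop :=
  exists q : {poly R}, coaction f - f%:P = q * ('X^M - 1).

(* X = Spec of this ring. *)
Definition OX : F -> Prop := fun f => exists g, mu_invariant g /\ f = g%:F.

Definition weight (v : 'X_{1..n}) : int := \sum_(i < n) d i * (v i)%:Z.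

(* O_X(j) *)
Definition OXj (j : int) : F -> Prop :=
  aspan (fun f => exists (a : k) (v : 'X_{1..n}),
    (weight v = j %[mod M])%Z /\ f = (a *: 'X_[v])%:F).

(* The ideal O_X(- D_i) of D_i = (x_i = 0) / mu_M in X. *)
Definition ideal_D (i : 'I_n) : F -> Prop := fun f =>
  exists g h : R, [/\ mu_invariant g, g = 'X_i * h & f = g%:F].

(* O_X(sum_i m_i D_i), the reflexive hull of the tensor product of the
   O_X(- D_i)^(- m_i) *)
Definition OXD (m : 'I_n -> int) : F -> Prop :=
  hull OX (\big[@mmul F/OX]_(i < n) mpow OX (ideal_D i) (- m i)).

(* L^[j](sum_i m_i D_i) *)
Definition rtwist (L : F -> Prop) (j : int) (m : 'I_n -> int) : F -> Prop :=
  hull OX (mmul (mpow OX L j) (OXD m)).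

Lemma mu_invariantC a : mu_invariant a%:MP.
Proof. by exists 0; rewrite /coaction mmapC /= subrr mul0r. Qed.

Lemma mu_invariantB f g : mu_invariant f -> mu_invariant g -> mu_invariant (f - g).
Proof.
move=> [p fE] [q gE]; exists (p - q).
rewrite mulrBl -fE -gE /coaction mmapB [(f - g)%:P]polyCB.
by rewrite !opprB addrACA [RHS]addrACA; congr (_ + _); apply: addrC.
Qed.

Lemma mu_invariantM f g : mu_invariant f -> mu_invariant g -> mu_invariant (f * g).
Proof.
move=> [p fE] [q gE]; exists (p * coaction g + f%:P * q).
rewrite mulrDl mulrAC -fE -mulrA -gE /coaction rmorphM /= polyCM.
by rewrite mulrBl mulrBr addrA subrK.
Qed.

Lemma OXC (a : k) : OX (a%:MP)%:F.
Proof. by exists a%:MP; split=> //; apply: mu_invariantC. Qed.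

Lemma OX_1 : OX 1.
Proof. by have := OXC 1; rewrite mpolyC1 rmorph1. Qed.

Lemma OX_B x y : OX x -> OX y -> OX (x - y).
Proof.
move=> [f [If ->]] [g [Ig ->]]; exists (f - g).
by split; [apply: mu_invariantB | rewrite tofracB].
Qed.

Lemma OX_M x y : OX x -> OX y -> OX (x * y).
Proof.
move=> [f [If ->]] [g [Ig ->]]; exists (f * g).
by split; [apply: mu_invariantM | rewrite tofracM].
Qed.

Lemma ideal_D_sub i f : ideal_D i f -> OX f.
Proof. by case=> g [h [Ig _ ->]]; exists g. Qed.

Lemma bigmmulM (I : Type) (r : seq I) (S T U : I -> F -> Prop) :
    (forall i f g, S i f -> T i g -> U i (f * g)) ->
  forall f g, (\big[@mmul F/OX]_(i <- r) S i) f ->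
    (\big[@mmul F/OX]_(i <- r) T i) g -> (\big[@mmul F/OX]_(i <- r) U i) (f * g).
Proof.
move=> STU; elim: r => [|i r IHr] f g; first by rewrite !big_nil; apply: OX_M.
by rewrite !big_cons; apply: mmulM => // x y; apply: STU.
Qed.

Lemma bigmmul1 (I : Type) (r : seq I) (S : I -> F -> Prop) :
  (forall i, S i 1) -> (\big[@mmul F/OX]_(i <- r) S i) 1.
Proof.
move=> S1; elim: r => [|i r IHr]; first by rewrite big_nil; apply: OX_1.
by rewrite big_cons -[1]mulr1; apply: mmulP.
Qed.

Lemma mpow_ideal_D1 i (m : int) : 0 <= m -> mpow OX (ideal_D i) (- m) 1.
Proof.
move=> m_ge0; apply: (mpow_anti OX_1 OX_B OX_M (j := 0)).
- exact: ideal_D_sub.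
- by rewrite oppr_le0.
- exact: OX_1.
Qed.

Lemma OXD_mul (m m' m'' : 'I_n -> int) f g : (forall i, m i + m' i <= m'' i) ->
  OXD m f -> OXD m' g -> OXD m'' (f * g).
Proof.
move=> le_m hf hg; have := hullM hf hg; apply: hullS => {f g hf hg}.
have D x y : (\big[@mmul F/OX]_(i < n) mpow OX (ideal_D i) (- m'' i)) x ->
    (\big[@mmul F/OX]_(i < n) mpow OX (ideal_D i) (- m'' i)) y ->
    (\big[@mmul F/OX]_(i < n) mpow OX (ideal_D i) (- m'' i)) (x + y).
  case: (index_enum _) => [|i r]; last by rewrite !big_cons; apply: aspanD.
  by rewrite !big_nil; apply: (subringD OX_1 OX_B).
have Z : (\big[@mmul F/OX]_(i < n) mpow OX (ideal_D i) (- m'' i)) 0.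
  case: (index_enum _) => [|i r]; last by rewrite !big_cons; apply: aspan0.
  by rewrite !big_nil; apply: (subring0 OX_1 OX_B).
apply: aspan_ind => // _ [f [g [hf hg ->]]]; move: f g hf hg.
apply: bigmmulM => i f g hf hg.
apply: (mpow_anti OX_1 OX_B OX_M (j := - m i - m' i)).
- exact: ideal_D_sub.
- by rewrite -opprD lerN2.
- exact: (mpowM OX_1 OX_B OX_M).
Qed.

Lemma rtwist_mul L i j (m m' m'' : 'I_n -> int) f g :
    (forall i, m i + m' i <= m'' i) ->
  rtwist L i m f -> rtwist L j m' g -> rtwist L (i + j) m'' (f * g).
Proof.
move=> le_m hf hg; have := hullM hf hg; apply: hullS => {f g hf hg}.
apply: aspan_ind => [|x y hx hy|_ [f [g [hf hg ->]]]].
- exact: aspan0.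
- exact: aspanD.
move: f g hf hg; apply: mmulM => x y.
- exact: (mpowM OX_1 OX_B OX_M).
- exact: OXD_mul.
Qed.

Section Seifert.

Variables (L : F -> Prop) (s : 'I_n -> rat).

Definition seifert_piece (j : int) : F -> Prop :=
  rtwist L j (fun i => Num.floor (j%:~R * s i)).

Definition monoE (f : F) (j : int) : E := (f%:P)%:F * ('X%:F) ^ j.

(* The graded ring sum_j L^[j](sum_i floor(j s_i) D_i) t^j inside the Laurent
   polynomials in t over F, which are themselves viewed inside F(t). *)
Definition seifert_set : E -> Prop :=
  aspan (fun y => exists f j, seifert_piece j f /\ y = monoE f j).


Lemma seifert_pieceM i j f g :
  seifert_piece i f -> seifert_piece j g -> seifert_piece (i + j) (f * g).
Proof.
apply: rtwist_mul => r; rewrite floor_ge_int rmorphD /= intrD mulrDl.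
by apply: lerD; apply: floor_le.
Qed.

Lemma seifert_pieceN i f : seifert_piece i f -> seifert_piece i (- f).
Proof. exact: (mdualN OX_1 OX_B). Qed.

Lemma seifert_piece0C (a : k) : seifert_piece 0 (a%:MP)%:F.
Proof.
apply: sub_hull; rewrite -[_%:F]mulr1; apply: mmulP; first exact: OXC.
apply: sub_hull; apply: bigmmul1 => i; rewrite mul0r floor0.
exact: mpow_ideal_D1.
Qed.

Lemma monoEM f g i j : monoE f i * monoE g j = monoE (f * g) (i + j).
Proof.
rewrite /monoE mulrACA polyCM rmorphM expfzDr //.
by rewrite tofrac_eq0 polyX_eq0.
Qed.

Lemma monoE1 : monoE 1 0 = 1.
Proof. by rewrite /monoE polyC1 tofrac1 expr0z mulr1. Qed.

Lemma seifert_setC (a : k) : seifert_set (monoE (a%:MP)%:F 0).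
Proof. by apply: aspan_id; exists (a%:MP)%:F, 0; split=> //; apply: seifert_piece0C. Qed.

Definition seifert_pred : {pred E} := fun y => `[< seifert_set y >].

Lemma seifert_subring : subring_closed seifert_pred.
Proof.
split=> [|x y /asboolP hx /asboolP hy|x y /asboolP hx /asboolP hy].
- apply/asboolP; have := seifert_setC 1.
  by rewrite mpolyC1 tofrac1 monoE1.
- apply/asboolP; apply: aspanD => //; apply: aspanN => // _ [f [j [hf ->]]].
  exists (- f), j; split; first exact: seifert_pieceN.
  by rewrite /monoE polyCN tofracN mulNr.
- apply/asboolP; move: x y hx hy; apply: aspanM => _ _ [f [i [hf ->]]] [g [j [hg ->]]].
  apply: aspan_id; exists (f * g), (i + j); rewrite monoEM; split=> //.
  exact: seifert_pieceM.
Qed.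

(* The coordinate ring of Y(L, sum_i s_i D_i) *)
Record seifert_ring := SeifertRing {
  seifert_val :> E; seifert_valP : seifert_val \in seifert_pred }.

HB.instance Definition _ := [isSub for seifert_val].
HB.instance Definition _ := [Choice of seifert_ring by <:].
HB.instance Definition _ := GRing.SubChoice_isSubComNzRing.Build E seifert_pred
  seifert_ring seifert_subring.

(* The structure map Y -> Spec k *)
Definition seifert_scalar (a : k) : seifert_ring :=
  SeifertRing (introT (asboolP _) (seifert_setC a)).

Lemma seifert_scalar_zmod : zmod_morphism seifert_scalar.
Proof.
move=> a b; apply: val_inj; rewrite raddfB /= /monoE.
by rewrite mpolyCB tofracB polyCB tofracB mulrBl.
Qed.

Lemma seifert_scalar_monoid : monoid_morphism seifert_scalar.
Proof.
split=> [|a b]; apply: val_inj => /=; first by rewrite mpolyC1 tofrac1 monoE1.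
by rewrite mpolyCM tofracM -[in LHS](addr0 0) -monoEM.
Qed.

HB.instance Definition _ :=
  GRing.isZmodMorphism.Build k seifert_ring seifert_scalar seifert_scalar_zmod.
HB.instance Definition _ :=
  GRing.isMonoidMorphism.Build k seifert_ring seifert_scalar seifert_scalar_monoid.

Definition smooth_Y : Prop := smooth seifert_scalar.

End Seifert.

(* The class of N in Cl(X) corresponds to r mod M under the isomorphism
   Z/M -> Cl(X), j |-> [O_X(j)]. *)
Definition Cl_residue (N : F -> Prop) (r : int) : Prop := misom OX N (OXj r).

End QuotientSingularity.

Arguments OX k {n} M d.
Arguments OXj k {n} M d j.
Arguments OXD k {n} M d m.
Arguments rtwist {k n} M d L j m.
Arguments smooth_Y {k n} M d L s.
Arguments Cl_residue {k n} M d N r.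

(* Main.v *)
Require Import Defs.
From HB Require Import structures.
From mathcomp Require Import all_boot all_order all_algebra.
From mathcomp Require Import fraction mpoly.
From mathcomp Require Import boolp qpoly zify ring.
Set Implicit Arguments.
Unset Strict Implicit.
Unset Printing Implicit Defensive.
Import Order.TTheory GRing.Theory Num.Theory.
Local Open Scope ring_scope.

(** All three conditions are conditions on exponents of monomials.

    The reflexive modules in the statement, inside the fraction field of the
    polynomial ring, are spanned by Laurent monomials: because of the hypothesis on
    the gcd of the d j, the dual of a module spanned by monomials, and with it the
    hull of a product of such modules, can be read off from the exponents
    (mdual_tight, rtwist_tight). Hence the coordinate ring of Y is the algebra k[S]
    (seifert_monoid_algebra), where S consists of the exponents (j, w) of monomials
    x ^ w * t ^ j in the lattice Lambda of solutions of sum_i d_i w_i = j l modulo M,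
    subject to the inequalities c_i w_i + b_i j >= 0 for all i.

    Y is smooth if and only if these n linear forms map Lambda onto Z^n. If they do,
    then S is isomorphic to N^n x Z, whose algebra is visibly smooth
    (facet_basis_smooth). Conversely, formal smoothness lifts every tangent vector of
    Y to jets k[z]/z^N of all orders, and comparing orders in z restricts the
    relations between irreducible elements of S (formally_smooth_relation). If the
    forms were not surjective, then some vector g on which the i-th form is 1 would
    be irreducible, and so would the least vectors on the coordinate axes; a multiple
    of g is a sum of the latter, and such a relation is impossible
    (smooth_facet_basis).

    The forms map Z x Z^n onto Z^n if and only if the c i are pairwise coprime, and
    their kernel is then generated by the vector with j = prod_i c_i and
    w_i = - b_i prod_(j <> i) c_j. Since Lambda is the kernel of the map
    (j, w) |-> j l - sum_i d_i w_i to Z / M, the forms restricted to Lambda remain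
    surjective if and only if this map takes the kernel vector to a generator of
    Z / M (facet_basis_chern, coprime_facet_basis). Its value is
    r = l prod_i c_i + sum_i d_i b_i prod_(j <> i) c_j.

    Finally, both sheaves in the statement are isomorphic to O_X(r), so the
    conditions (b) say that r is prime to M as soon as j |-> O_X(j) identifies Z / M
    with the class group of X. It is injective because an isomorphism is the
    multiplication by a unit of the polynomial ring, a constant (misom_slab_congr).
    It is surjective because the polynomial ring is factorial (factorial_mpoly): the
    extension to it of a rank 1 reflexive module has a reflexive hull generated by
    one element, which is homogeneous for the grading by Z / M (reflexive_slab). *)

Local Notation "x %:F" := (@tofrac _ x) : ring_scope.

(** * Factoriality of polynomial rings *)

Section Factorial.

Variable R : idomainType.
Implicit Types (x y p q : R) (s : seq R).

Definition divides x y := exists z, y = z * x.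

Definition prime_element p :=
  [/\ p != 0, p \isn't a GRing.unit &
    forall x y, divides p (x * y) -> divides p x \/ divides p y].

Definition factorial_at x := exists u s,
  [/\ u \is a GRing.unit, forall p, p \in s -> prime_element p
    & x = u * \prod_(p <- s) p].

(** Primes, rather than irreducible elements, are required: existence of such a
    factorization is then equivalent to unique factorization. *)
Definition factorial_domain := forall x, x != 0 -> factorial_at x.

Lemma factorial_at_unit u : u \is a GRing.unit -> factorial_at u.
Proof. by move=> Uu; exists u, [::]; rewrite big_nil mulr1. Qed.

Lemma factorial_at_prime p : prime_element p -> factorial_at p.
Proof.
move=> Pp; exists 1, [:: p]; rewrite unitr1 big_seq1 mul1r; split=> // q.
by rewrite inE => /eqP->.
Qed.

Lemma factorial_atM x y : factorial_at x -> factorial_at y -> factorial_at (x * y).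
Proof.
move=> [u [s [Uu Ps ->]]] [v [t [Uv Pt ->]]]; exists (u * v), (s ++ t).
rewrite unitrM Uu Uv big_cat mulrACA; split=> // p.
by rewrite mem_cat => /orP[/Ps|/Pt].
Qed.

Lemma prime_element_ndvd_unit p u : prime_element p -> u \is a GRing.unit ->
  ~ divides p u.
Proof.
case=> p0 pNU _ Uu [z zE]; case/negP: pNU.
by move: Uu; rewrite zE unitrM => /andP[].
Qed.

(** Only the primes of x can occur in a gcd of x and y, and each of them
    either divides y, in which case it is split off both, or is cancelled from
    every multiple that is divisible by it. *)
Lemma factorial_gcd x y : factorial_at x ->
  exists g, [/\ divides g x, divides g y &
    forall p q, divides p (x * q) -> divides p (y * q) -> divides p (g * q)].
Proof.
move=> [u [s [Uu Ps ->]]].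
elim: s y Ps => [|r s IHs] y Ps.
  rewrite big_nil mulr1; exists 1; split.
  - by exists u; rewrite mulr1.
  - by exists y; rewrite mulr1.
  - move=> p q [z zE] _; exists (u^-1 * z).
    by rewrite -mulrA -zE mulrA mulVr.
have [r0 _ rP] : prime_element r by apply: Ps; rewrite mem_head.
have {}IHs z := IHs z (fun p sp => Ps p (mem_behead (sp : p \in behead (r :: s)))).
rewrite big_cons mulrCA; move: {Ps}(u * _) IHs => x1 IHs.
have [[y1 ->]|rNy] := pselect (divides r y).
  have [g [[a gx] [b gy] gP]] := IHs y1; exists (r * g); split.
  - by exists a; rewrite gx mulrCA.
  - by exists b; rewrite gy mulrAC mulrA.
  move=> p q hx hy; rewrite [r * g]mulrC -mulrA; apply: gP.
    by rewrite mulrA [x1 * r]mulrC.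
  by rewrite mulrA.
have [g [[a gx] gy gP]] := IHs y; exists g; split=> //.
  by exists (r * a); rewrite gx mulrA.
move=> p q [z zE] [t tE]; apply: gP; last by exists t.
have [p0|p0] := eqVneq p 0.
  exists 0; rewrite mul0r; apply: (mulfI r0).
  by rewrite mulrA zE p0 !mulr0.
have /rP[[w wE]|//] : divides r (z * y).
  exists (x1 * t); apply: (mulIf p0).
  have -> : z * y * p = y * (z * p) by ring.
  have -> : x1 * t * r * p = r * x1 * (t * p) by ring.
  by rewrite -zE -tE; ring.
by exists w; apply: (mulfI r0); rewrite mulrA zE wE; ring.
Qed.

End Factorial.

Section GaussLemma.

Import Pdiv.Idomain.

Variable R : idomainType.
Implicit Types (a c x y p q : R) (f g h : {poly R}).

Lemma divides_polyC p f : divides p%:P f <-> forall i, divides p f`_i.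
Proof.
split=> [[g ->] i|pf]; first by exists g`_i; rewrite coefMC.
elim/poly_ind: f pf => [|f a IHf] pf; first by exists 0; rewrite mul0r.
have [g ->] : divides p%:P f.
  by apply: IHf => i; have := pf i.+1; rewrite coefD coefMX coefC addr0.
have [b ->] : divides p a by have := pf 0; rewrite coefD coefMX coefC add0r.
by exists (g * 'X + b%:P); rewrite polyCM; ring.
Qed.

(** A constant term divisible by p may be dropped from either factor, after
    which the factor is divided by the variable. *)
Lemma prime_polyC p : prime_element p -> prime_element p%:P.
Proof.
case=> p0 pNU pP; split; rewrite ?polyC_eq0 //.
  by rewrite poly_unitE size_polyC p0 coefC.
move=> f g; have [n] := ubnP (size f + size g)%N; elim: n f g => // n IHn f g.
elim/poly_ind: f => [|f a _] sfg fg; first by left; exists 0; rewrite mul0r.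
elim/poly_ind: g sfg fg => [|g b _] sfg fg; first by right; exists 0; rewrite mul0r.
have [zf|nzf] := eqVneq (f * 'X + a%:P) 0.
  by left; exists 0; rewrite zf mul0r.
have [zg|nzg] := eqVneq (g * 'X + b%:P) 0.
  by right; exists 0; rewrite zg mul0r.
have XP h : divides p%:P (h * 'X) -> divides p%:P h.
  move=> /divides_polyC ph; apply/divides_polyC => i.
  by have := ph i.+1; rewrite coefMX.
have szX h c : h * 'X + c%:P != 0 -> (size h < size (h * 'X + c%:P)%R)%N.
  rewrite size_MXaddC; case: (h =P 0) => //= -> nz.
  by case: (c =P 0) nz => //= ->; rewrite mul0r addr0 eqxx.
have [[a' aE]|[b' bE]] : divides p a \/ divides p b.
- apply: pP; move/divides_polyC/(_ 0): fg.
  by rewrite coef0M !coefD !coefMX !coefC !add0r.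
- have [||[f' ->]|pg] := IHn f (g * 'X + b%:P).
  + by rewrite -ltnS; apply: leq_ltn_trans sfg; rewrite ltn_add2r szX.
  + apply: XP; case: fg => h hE; exists (h - a'%:P * (g * 'X + b%:P)).
    by rewrite mulrBl -hE aE polyCM; ring.
  + by left; exists (f' * 'X + a'%:P); rewrite aE polyCM; ring.
  + by right.
- have [||pf|[g' ->]] := IHn (f * 'X + a%:P) g.
  + by rewrite -ltnS; apply: leq_ltn_trans sfg; rewrite ltn_add2l szX.
  + apply: XP; case: fg => h hE; exists (h - b'%:P * (f * 'X + a%:P)).
    by rewrite mulrBl -hE bE polyCM; ring.
  + by left.
  + by right; exists (g' * 'X + b'%:P); rewrite bE polyCM; ring.
Qed.

Definition primitive_poly f := forall p, prime_element p -> ~ divides p%:P f.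

Hypothesis factR : factorial_domain R.

Lemma factorial_at_polyC a : a != 0 -> factorial_at a%:P.
Proof.
move=> /factR[u [s [Uu Ps ->]]]; rewrite polyCM; apply: factorial_atM.
  by apply: factorial_at_unit; rewrite rmorph_unit.
elim: s Ps => [|p s IHs] Ps.
  by rewrite big_nil; apply: factorial_at_unit; apply: unitr1.
rewrite big_cons polyCM; apply: factorial_atM.
  by apply/factorial_at_prime/prime_polyC/Ps; rewrite mem_head.
by apply: IHs => q sq; apply: Ps; rewrite inE sq orbT.
Qed.

(** The content of f is the gcd of its coefficients. *)
Lemma content_exists f : f != 0 ->
  exists c g, [/\ c != 0, f = c%:P * g & primitive_poly g].
Proof.
move=> f0.
have [c [cf cP]] : exists c, divides c%:P f /\
    forall q, divides q%:P f -> divides q c.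
  elim/poly_ind: (f) => [|g a [c [cg cP]]].
    by exists 0; split=> [|q _]; exists 0; rewrite ?mulr0 ?mul0r.
  have gaP q : divides q%:P (g * 'X + a%:P) -> divides q%:P g /\ divides q a.
    move=> /divides_polyC qf; split.
      apply/divides_polyC=> i.
      by have := qf i.+1; rewrite coefD coefMX coefC addr0.
    by have := qf 0; rewrite coefD coefMX coefC add0r.
  have [a0|a0] := eqVneq a 0.
    exists c; split=> [|q /gaP[qg _]]; last exact: cP.
    by rewrite a0 addr0; case: cg => z ->; exists (z * 'X); ring.
  have [d [[b da] [e dc] dP]] := factorial_gcd c (factR a0).
  exists d; split.
    case: cg => z ->; exists (z * e%:P * 'X + b%:P).
    by rewrite da dc !polyCM; ring.
  move=> q /gaP[/cP qc qa].
  by have := dP q 1; rewrite !mulr1; apply.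
have [g gE] := cf; exists c, g.
have c0 : c != 0 by apply: contra_neq f0 => c0; rewrite gE c0 mulr0.
split=> [//||p Pp [h hE]]; first by rewrite gE mulrC.
have [z zE] : divides (c * p) c.
  by apply: cP; exists h; rewrite gE hE polyCM; ring.
have := prime_element_ndvd_unit Pp (unitr1 R); apply; exists z.
by apply: (mulfI c0); rewrite mulr1 [LHS]zE; ring.
Qed.

(** The primes of a do not divide the primitive f, so they divide the cofactor and
    are cancelled one at a time. *)
Lemma primitive_cancel a f g : a != 0 -> primitive_poly f ->
  divides f (a%:P * g) -> divides f g.
Proof.
move=> a0 prf; have [u [s [Uu Ps ->]]] := factR a0.
elim: s Ps g => [|p s IHs] Ps g.
  rewrite big_nil mulr1 => -[h hE]; exists ((u^-1)%:P * h).
  by rewrite -mulrA -hE mulrA -polyCM mulVr // mul1r.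
rewrite big_cons => -[h hE]; apply: IHs => [q sq|].
  by apply: Ps; rewrite inE sq orbT.
have Pp : prime_element p by apply: Ps; rewrite mem_head.
have [p0 _ pP] := prime_polyC Pp.
have [|[h' h'E]|/(prf p Pp)//] := pP h f.
  by exists (u%:P * (\prod_(q <- s) q)%:P * g); rewrite -hE !polyCM; ring.
exists h'; apply: (mulfI p0); rewrite [LHS]mulrA -polyCM mulrCA hE h'E; ring.
Qed.

(** Each prime of a divides one of the two factors. *)
Lemma polyC_factor_split a f g h : a != 0 -> a%:P * f = g * h ->
  exists g' h', [/\ f = g' * h', (size g' <= size g)%N & (size h' <= size h)%N].
Proof.
move=> a0; have [u [s [Uu Ps ->]]] := factR a0.
elim: s Ps g h => [|p s IHs] Ps g h.
  rewrite big_nil mulr1 => hE; exists ((u^-1)%:P * g), h; split=> //.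
    by rewrite -mulrA -hE mulrA -polyCM mulVr // mul1r.
  by rewrite mul_polyC size_scale_leq.
have Pp : prime_element p by apply: Ps; rewrite mem_head.
have Pss q : q \in s -> prime_element q.
  by move=> sq; apply: Ps; rewrite inE sq orbT.
have [p0 _ pP] := prime_polyC Pp.
have szp (q : {poly R}) : size (q * p%:P) = size q.
  by rewrite mulrC mul_polyC size_scale // -polyC_eq0.
rewrite big_cons => hE.
have [|[g' gE]|[h' h'E]] := pP g h.
- exists (u%:P * (\prod_(q <- s) q)%:P * f); rewrite -hE !polyCM; ring.
- have [|g1 [h1 [fE sg sh]]] := IHs Pss g' h.
    by apply: (mulfI p0); rewrite [LHS]mulrA -polyCM mulrCA hE gE; ring.
  by exists g1, h1; rewrite gE szp.
- have [|g1 [h1 [fE sg sh]]] := IHs Pss g h'.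
    by apply: (mulfI p0); rewrite [LHS]mulrA -polyCM mulrCA hE h'E; ring.
  by exists g1, h1; rewrite h'E szp.
Qed.

(** Over an integral domain, divisibility in the sense of pseudo-division is
    divisibility up to a nonzero constant, that is, over the fraction field;
    there an irreducible f is prime, and the constant is cancelled against a
    primitive f. *)
Lemma irreducible_primitive_prime f : irreducible_poly f -> primitive_poly f ->
  prime_element f.
Proof.
move=> irf prf; have [szf _] := irf; split.
- exact: irredp_neq0.
- by rewrite poly_unitE; case: (size f) szf => [|[]].
have dvdE g : f %| g -> divides f g.
  case/dvdpP=> -[a q] /= a0 gE; apply: (primitive_cancel a0) => //.
  by exists q; rewrite mul_polyC.
move=> g h [q gh]; have fgh : f %| g * h by rewrite gh dvdp_mulIr.
have [/dvdE|fNg] := boolP (f %| g); first by left.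
right; apply: dvdE; move: fgh; rewrite Gauss_dvdpr //.
apply/coprimepP => e ef eg; rewrite -size_poly_eq1.
apply: contraNT fNg => e1; have [_ /(_ e e1 ef)/andP[_ fe]] := irf.
exact: dvdp_trans eg.
Qed.

(** Gauss's lemma: the content of f is a product of primes, and the primitive part
    is prime when it is irreducible over the fraction field, or else splits into
    two factors of smaller degree after the denominators are cancelled. *)
Theorem factorial_poly : factorial_domain {poly R}.
Proof.
move=> f; have [n] := ubnP (size f); elim: n f => // n IHn f szf f0.
have [c [g [c0 fE prg]]] := content_exists f0.
have g0 : g != 0 by apply: contra_neq f0 => g0; rewrite fE g0 mulr0.
rewrite fE; apply: factorial_atM; first exact: factorial_at_polyC.
have szg : size f = size g by rewrite fE mul_polyC size_scale.
have [sg1|sg1] := leqP (size g) 1.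
  move: g0 prg; rewrite (size1_polyC sg1) polyC_eq0 => a0 prg.
  apply: factorial_at_unit; apply: rmorph_unit.
  have [u [[|p s] [Uu Ps aE]]] := factR a0.
    by rewrite aE big_nil mulr1.
  have Pp : prime_element p by apply: Ps; rewrite mem_head.
  case: (prg p Pp); exists (u * \prod_(q <- s) q)%:P.
  by rewrite aE big_cons !polyCM; ring.
have [irg|Nirg] := pselect (irreducible_poly g).
  exact/factorial_at_prime/irreducible_primitive_prime.
have [q [sq1 qg Nqg]] : exists q : {poly R}, [/\ size q != 1, q %| g & ~~ (q %= g)].
  apply: contra_notP Nirg => Nq; split=> // q sq1 qg; apply/negPn/negP => qNg.
  by apply: Nq; exists q.
have q0 : q != 0 by apply: contraTneq qg => ->; rewrite dvd0p.
have [[a h] /= a0 hE] := dvdpP _ _ qg.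
have h0 : h != 0.
  apply: contraNneq g0 => h0; move/eqP: hE.
  by rewrite h0 mul0r -mul_polyC mulf_eq0 polyC_eq0 (negPf a0).
have ltq : (size q < size g)%N.
  by rewrite ltn_neqAle dvdp_size_eqp // Nqg dvdp_leq.
have szh : (size g = (size h + size q).-1)%N by rewrite -size_mul // -hE size_scale.
have [|g' [h' [gE sg' sh']]] := @polyC_factor_split a g h q a0.
  by rewrite mul_polyC.
have gh0 : (g' != 0) && (h' != 0) by rewrite -negb_or -mulf_eq0 -gE.
have [g'0 h'0] := andP gh0.
have sq : (1 < size q)%N by move: q0 sq1; rewrite -size_poly_gt0; case: (size q) => [|[]].
by rewrite gE; apply: factorial_atM; apply: IHn => //; lia.
Qed.

End GaussLemma.

Lemma factorial_iso (R S : idomainType) (f : {rmorphism R -> S}) :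
    injective f -> (forall y, exists x, f x = y) ->
  factorial_domain S -> factorial_domain R.
Proof.
move=> f_inj f_surj factS x x0.
have fU y : (f y \is a GRing.unit) -> y \is a GRing.unit.
  move=> Uy; have [z zE] := f_surj (f y)^-1; apply/unitrPr; exists z.
  by apply: f_inj; rewrite rmorphM rmorph1 zE divrr.
have fdiv y z : divides (f y) (f z) -> divides y z.
  case=> w wE; have [v vE] := f_surj w; exists v.
  by apply: f_inj; rewrite rmorphM vE.
have fprime p : prime_element (f p) -> prime_element p.
  case=> p0 pNU pP; split.
  - by apply: contra_neq p0 => ->; rewrite rmorph0.
  - by apply: contra pNU => /(rmorph_unit f).
  - move=> y z [w wE]; have [|/fdiv|/fdiv] := pP (f y) (f z); try by [left|right].
    by exists (f w); rewrite -!rmorphM wE.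
have fx0 : f x != 0 by rewrite -(rmorph0 f) (inj_eq f_inj).
have [u [s [Uu Ps xE]]] := factS _ fx0.
have [v vE] := f_surj u.
have [t [Pt tE]] : exists t, (forall p, p \in t -> prime_element p) /\
    f (\prod_(p <- t) p) = \prod_(p <- s) p.
  elim: s Ps {xE} => [|p s IHs] Ps; first by exists [::]; rewrite !big_nil rmorph1.
  have [|t [Pt tE]] := IHs; first by move=> q sq; apply: Ps; rewrite inE sq orbT.
  have [q qE] := f_surj p; exists (q :: t); rewrite !big_cons rmorphM tE qE.
  split=> // r; rewrite inE => /orP[/eqP->|/Pt//].
  by apply: fprime; rewrite qE; apply: Ps; rewrite mem_head.
exists v, t; split=> //; first by apply: fU; rewrite vE.
by apply: f_inj; rewrite rmorphM vE tE.
Qed.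

Section MpolyUni.

Variables (k : fieldType) (n : nat).

(** An exponent is determined by its last entry, which becomes the power of the new
    variable, and by the rest, which is read off from the coefficient. *)
Lemma muni_inj : injective (@muni n k).
Proof.
apply: raddf_inj => p p0; apply/mpolyP => m; rewrite mcoeff0.
have p1 : muni p = 0 := p0; move: p1; rewrite muniE.
pose m' := [multinom m (widen_ord (leqnSn n) i) | i < n].
move=> /(congr1 (fun q : {poly {mpoly k[n]}} => (q`_(m ord_max))@_m')).
rewrite /m' {m'}.
rewrite coef0 mcoeff0 coef_sum raddf_sum /= => <-.
transitivity (\sum_(m' <- msupp p) p@_m' * (m' == m)%:R).
  have [pm|pm] := boolP (m \in msupp p).
    rewrite (bigD1_seq m) ?msupp_uniq //= eqxx mulr1 big1 ?addr0 // => m' /negPf->.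
    by rewrite mulr0.
  rewrite big1_seq ?memN_msupp_eq0 // => m' /= pm'.
  by case: eqP pm pm' => [->|_ _ _]; rewrite ?mulr0 // => /negPf->.
apply: eq_bigr => m' _; rewrite coefZ coefXn -scalerAl mcoeffZ.
rewrite [in RHS]mulr_natr mcoeffMn mcoeffX -mulrnA; congr (_ * _%:R).
rewrite mulnb; congr nat_of_bool.
apply/eqP/andP => [->|[/eqP/mnmP e1 /eqP e2]]; first by rewrite !eqxx.
apply/mnmP => i.
have [j ->|->] := unliftP ord_max i; last by [].
have := e1 j; rewrite !mnmE; congr (_ = _); congr (_ _); apply/val_inj => /=;
  by rewrite /bump leqNgt ltn_ord.
Qed.

Lemma muni_surj q : exists p, @muni n k p = q.
Proof.
pose w (m : 'X_{1..n}) i : 'X_{1..n.+1} :=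
  [multinom if unlift ord_max j is Some j' then m j' else i | j < n.+1].
have wE m i : muni 'X_[w m i] = 'X_[k, m] *: 'X^i.
  rewrite muniE msuppX big_seq1 mcoeffX eqxx scale1r; congr ('X_[_] *: 'X^_).
    apply/mnmP => j; rewrite !mnmE.
    have -> : widen_ord (leqnSn n) j = lift ord_max j.
      by apply/val_inj; rewrite /= /bump leqNgt ltn_ord.
    by rewrite liftK.
  by rewrite mnmE unlift_none.
exists (\sum_(i < size q) \sum_(m <- msupp q`_i) q`_i@_m *: 'X_[w m i]).
rewrite raddf_sum -[RHS]coefK poly_def; apply: eq_bigr => i _.
rewrite raddf_sum [in RHS](mpolyE q`_i) scaler_suml; apply: eq_bigr => m _.
by rewrite /= muniZ wE scalerA mul_mpolyC.
Qed.

End MpolyUni.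

Theorem factorial_mpoly (k : fieldType) n : factorial_domain {mpoly k[n]}.
Proof.
elim: n => [|n IHn].
  move=> p p0; apply/factorial_at_unit/unitrPr.
  have pE : p = (p@_0)%:MP.
    apply/mpolyP => m; rewrite mcoeffC.
    by have -> : m = 0%MM; [apply/mnmP => -[] | rewrite eqxx mulr1].
  have c0 : p@_0 != 0 by apply: contra_neq p0 => c0; rewrite pE c0 mpolyC0.
  by exists (p@_0)^-1%:MP; rewrite pE -mpolyCM mcoeffC eqxx mulr1 divff.
exact: (factorial_iso (@muni_inj k n) (@muni_surj k n) (factorial_poly IHn)).
Qed.

(** * Monoid algebras *)

Section LinearCombinations.

Variables (k : fieldType) (L : zmodType).
Implicit Types (r : seq (k * L)) (S : L -> Prop) (v w : L).

Definition coef_at r w : k := \sum_(x <- r | x.2 == w) x.1.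

Definition supported S r := forall x, x \in r -> S x.2.

Definition negate r := [seq (- x.1, x.2) | x <- r].

Definition convolve r r' := [seq (x.1 * y.1, x.2 + y.2) | x <- r, y <- r'].

Lemma supported_cat S r r' : supported S r -> supported S r' -> supported S (r ++ r').
Proof. by move=> Sr Sr' x; rewrite mem_cat => /orP[/Sr|/Sr']. Qed.

Lemma supported_negate S r : supported S r -> supported S (negate r).
Proof. by move=> Sr _ /mapP[x /Sr Sx ->]. Qed.

Lemma supported_convolve S S' T r r' : (forall v w, S v -> S' w -> T (v + w)) ->
  supported S r -> supported S' r' -> supported T (convolve r r').
Proof.
move=> ST Sr Sr' _ /allpairsP[[x y] /= [rx ry ->]].
by apply: ST; [apply: (Sr x) | apply: (Sr' y)].
Qed.

Lemma coef_at_subr r r' w : coef_at (r ++ negate r') w = coef_at r w - coef_at r' w.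
Proof.
by rewrite /coef_at big_cat big_map /= -sumrN.
Qed.

Lemma coef_at_supported S r w : supported S r -> coef_at r w != 0 -> S w.
Proof.
move=> Sr; have [/hasP[x rx /eqP<-] _|Nw] := boolP (has (fun x => x.2 == w) r).
  exact: Sr.
by rewrite /coef_at big_hasC // eqxx.
Qed.

Section OneRing.

Variables (B : comPzRingType) (phi : {rmorphism k -> B}) (chi : L -> B).

Definition lin_comb r : B := \sum_(x <- r) phi x.1 * chi x.2.

Lemma lin_comb_subr r r' : lin_comb (r ++ negate r') = lin_comb r - lin_comb r'.
Proof.
rewrite /lin_comb big_cat big_map /= -sumrN; congr (_ + _).
by apply: eq_bigr => x _; rewrite rmorphN mulNr.
Qed.

Lemma lin_comb_coef_at r :
  lin_comb r = \sum_(w <- undup [seq x.2 | x <- r]) phi (coef_at r w) * chi w.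
Proof.
rewrite /coef_at; under [RHS]eq_bigr do rewrite rmorph_sum mulr_suml.
rewrite (exchange_big_dep predT) //= [LHS]big_seq [RHS]big_seq.
apply: eq_bigr => x rx; have xr : x.2 \in undup [seq y.2 | y <- r].
  by rewrite mem_undup map_f.
by rewrite (big_rem _ xr) /= eqxx big1_seq ?addr0 // => w /andP[/eqP<-];
  rewrite mem_rem_uniq ?undup_uniq // inE eqxx.
Qed.

Lemma lin_comb_convolve S S' r r' :
    (forall v w, S v -> S' w -> chi (v + w) = chi v * chi w) ->
  supported S r -> supported S' r' ->
  lin_comb (convolve r r') = lin_comb r * lin_comb r'.
Proof.
move=> chiM Sr Sr'; rewrite /lin_comb big_allpairs_dep /= mulr_suml.
rewrite [LHS]big_seq [RHS]big_seq; apply: eq_bigr => x /Sr Sx.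
rewrite mulr_sumr [LHS]big_seq [RHS]big_seq; apply: eq_bigr => y /Sr' Sy.
by rewrite rmorphM chiM //; ring.
Qed.

(** Linear independence of the chi w with w in S, repetitions in a combination
    being allowed and collected by coef_at. *)
Definition free_on S :=
  forall r, supported S r -> lin_comb r = 0 -> forall w, coef_at r w = 0.

Definition kspan S (f : B) := exists2 r, supported S r & f = lin_comb r.

Lemma kspanS S S' f : (forall w, S w -> S' w) -> kspan S f -> kspan S' f.
Proof. by move=> SS' [r Sr ->]; exists r => // x /Sr/SS'. Qed.

Lemma kspan0 S : kspan S 0.
Proof. by exists [::] => //; rewrite /lin_comb big_nil. Qed.

Lemma kspanD S f g : kspan S f -> kspan S g -> kspan S (f + g).
Proof.
move=> [r Sr ->] [r' Sr' ->]; exists (r ++ r'); first exact: supported_cat.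
by rewrite /lin_comb big_cat.
Qed.

Lemma kspan_mono S a w : S w -> kspan S (phi a * chi w).
Proof.
move=> Sw; exists [:: (a, w)]; last by rewrite /lin_comb big_seq1.
by move=> x; rewrite inE => /eqP->.
Qed.

Lemma kspan_ind S (Q : B -> Prop) : Q 0 -> (forall f g, Q f -> Q g -> Q (f + g)) ->
  (forall a w, S w -> Q (phi a * chi w)) -> forall f, kspan S f -> Q f.
Proof.
move=> Q0 QD QS _ [r Sr ->]; rewrite /lin_comb big_seq.
by apply: big_ind => // x /Sr; apply: QS.
Qed.

Lemma free_coef_at_eq S r r' : free_on S -> supported S r -> supported S r' ->
  lin_comb r = lin_comb r' -> coef_at r =1 coef_at r'.
Proof.
move=> frS Sr Sr' rr' w; apply/eqP; rewrite -subr_eq0 -coef_at_subr.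
rewrite frS //; last by rewrite lin_comb_subr rr' subrr.
by apply: supported_cat => //; apply: supported_negate.
Qed.

(** By linear independence all expressions of f have the same exponents with
    nonzero coefficient. *)
Lemma kspan_forall (I : Type) (S : I -> L -> Prop) f : free_on (fun _ => True) ->
    inhabited I -> (forall i, kspan (S i) f) ->
  kspan (fun w => forall i, S i w) f.
Proof.
move=> frT [i0] Sf; have [r Sr fE] := Sf i0.
exists [seq (coef_at r w, w) | w <- undup [seq x.2 | x <- r] & coef_at r w != 0].
  move=> _ /mapP[w + ->] i /=; rewrite mem_filter => /andP[rw _].
  have [r' Sr' f'E] := Sf i; apply: (coef_at_supported (w := w) Sr').
  by rewrite -(@free_coef_at_eq _ r r' frT) // -fE.
rewrite fE lin_comb_coef_at /lin_comb big_map big_filter /=.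
rewrite [RHS]big_mkcond; apply: eq_bigr => w _ /=.
by case: eqP => //= ->; rewrite rmorph0 mul0r.
Qed.

(** B is the monoid algebra k[S], with chi s the element of the basis indexed
    by s. *)
Record monoid_algebra S : Prop := MonoidAlgebra {
  monoid0 : S 0;
  monoidD : forall s t, S s -> S t -> S (s + t);
  mono0 : chi 0 = 1;
  monoD : forall s t, S s -> S t -> chi (s + t) = chi s * chi t;
  mono_free : free_on S;
  mono_span : forall b, kspan S b }.

End OneRing.

Lemma lin_comb_rmorph (B C : comPzRingType) (phi : {rmorphism k -> B})
    (psi : {rmorphism k -> C}) (chi : L -> B) (theta : L -> C) S r
    (u : {rmorphism B -> C}) :
    (forall a, u (phi a) = psi a) -> (forall s, S s -> u (chi s) = theta s) ->
  supported S r -> u (lin_comb phi chi r) = lin_comb psi theta r.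
Proof.
move=> uphi uchi Sr; rewrite rmorph_sum /lin_comb [LHS]big_seq [RHS]big_seq.
by apply: eq_bigr => x /Sr/uchi uE; rewrite rmorphM uphi uE.
Qed.

Section UniversalProperty.

Variables (B : comPzRingType) (phi : {rmorphism k -> B}) (chi : L -> B).
Variable S : L -> Prop.
Hypothesis algS : monoid_algebra phi chi S.

(** Linear independence makes the value of the extension of theta independent of
    the expression of an element as a combination of monomials. *)
Lemma monoid_algebra_hom (C : comPzRingType) (psi : {rmorphism k -> C})
    (theta : L -> C) :
    theta 0 = 1 -> (forall s t, S s -> S t -> theta (s + t) = theta s * theta t) ->
  exists v : {rmorphism B -> C},
    (forall a, v (phi a) = psi a) /\ (forall s, S s -> v (chi s) = theta s).
Proof.
move=> theta0 thetaD; have [S0 SD chi0 chiD frS spS] := algS.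
have rep b : {r | supported S r /\ b = lin_comb phi chi r}.
  by apply: cid; have [r Sr rE] := spS b; exists r.
pose v b := lin_comb psi theta (sval (rep b)).
have vE r : supported S r -> v (lin_comb phi chi r) = lin_comb psi theta r.
  move=> Sr; rewrite /v; case: (rep _) => r' /= [Sr' r'E].
  apply/eqP; rewrite -subr_eq0 -lin_comb_subr lin_comb_coef_at big1 // => w _.
  by rewrite coef_at_subr (free_coef_at_eq frS Sr Sr' r'E) subrr rmorph0 mul0r.
have vphi a : v (phi a) = psi a.
  have -> : phi a = lin_comb phi chi [:: (a, 0)].
    by rewrite /lin_comb big_seq1 chi0 mulr1.
  rewrite vE; first by rewrite /lin_comb big_seq1 theta0 mulr1.
  by move=> x; rewrite inE => /eqP->.
have vchi s : S s -> v (chi s) = theta s.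
  move=> Ss; have -> : chi s = lin_comb phi chi [:: (1, s)].
    by rewrite /lin_comb big_seq1 rmorph1 mul1r.
  rewrite vE; first by rewrite /lin_comb big_seq1 rmorph1 mul1r.
  by move=> x; rewrite inE => /eqP->.
have vB : zmod_morphism v.
  move=> x y; have [r Sr ->] := spS x; have [t St ->] := spS y.
  rewrite -lin_comb_subr !vE ?lin_comb_subr //.
  by apply: supported_cat => //; apply: supported_negate.
have vM : monoid_morphism v.
  split=> [|x y]; first by rewrite -chi0 vchi // theta0.
  have [r Sr ->] := spS x; have [t St ->] := spS y.
  rewrite -(lin_comb_convolve _ chiD) // !vE ?(lin_comb_convolve _ thetaD) //.
  exact: (supported_convolve SD Sr St).
pose v1 := GRing.isZmodMorphism.Build B C v vB.
pose v2 := GRing.isMonoidMorphism.Build B C v vM.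
pose vR : {rmorphism B -> C} := HB.pack v v1 v2.
by exists vR.
Qed.

Lemma monoid_algebra_hom_eq (C : comPzRingType) (u v : {rmorphism B -> C}) :
    (forall a, u (phi a) = v (phi a)) -> (forall s, S s -> u (chi s) = v (chi s)) ->
  u =1 v.
Proof.
move=> uvphi uvchi b; have [r Sr ->] := mono_span algS b.
pose psi : {rmorphism k -> C} := v \o phi.
by rewrite !(@lin_comb_rmorph _ _ phi psi chi (v \o chi) S).
Qed.

End UniversalProperty.

End LinearCombinations.

(** * Laurent monomials in the function fields *)

Section Characters.

Variables (k : fieldType) (L : zmodType) (F : fieldType).
Variables (phi : {rmorphism k -> F}) (chi : L -> F).
Hypothesis chi0 : chi 0 = 1.
Hypothesis chiD : forall v w, chi (v + w) = chi v * chi w.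
Hypothesis freeT : free_on phi chi (fun _ => True).

Implicit Types (S T : L -> Prop).

Local Notation kspan := (kspan phi chi).

Lemma kspan_shift S v f : kspan S (chi v * f) <-> kspan (fun w => S (v + w)) f.
Proof.
have chiM u T g : kspan T g -> kspan (fun w => T (w - u)) (chi u * g).
  move: g; apply: kspan_ind => [|f' g Qf Qg|a w Tw].
  - by rewrite mulr0; apply: kspan0.
  - by rewrite mulrDr; apply: kspanD.
  by rewrite mulrCA -chiD; apply: kspan_mono; rewrite addrC addKr.
split=> [/(chiM (- v))|/(chiM v)]; last first.
  by apply: kspanS => w; rewrite addrC subrK.
rewrite mulrA -chiD addNr chi0 mul1r.
by apply: kspanS => w; rewrite opprK addrC.
Qed.

Lemma mmul_kspan S T :
  mmul (kspan S) (kspan T) = kspan (fun w => exists s t, [/\ S s, T t & w = s + t]).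
Proof.
apply: funext => f; apply: propext; split; move: f.
  apply: aspan_ind => [|f g|_ [f [g [[r Sr ->] [t St ->] ->]]]].
  - exact: kspan0.
  - exact: kspanD.
  rewrite -(@lin_comb_convolve _ _ _ _ _ S T) //.
  exists (convolve r t) => //; apply: (supported_convolve _ Sr St) => v w Sv Tw.
  by exists v, w.
apply: kspan_ind => [|f g|a _ [s [t [Ss Tt ->]]]].
- exact: aspan0.
- exact: aspanD.
rewrite chiD mulrA; apply: mmulP; first exact: kspan_mono.
by rewrite -[chi t]mul1r -(rmorph1 phi); apply: kspan_mono.
Qed.

(** An f that multiplies every chi v with v in T into the span of S lies in the
    span of S - v for each v in T, hence in the span of their intersection. *)
Lemma mdual_kspan S T : (exists v, T v) ->
  mdual (kspan S) (kspan T) = kspan (fun w => forall v, T v -> S (v + w)).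
Proof.
move=> [v0 Tv0]; apply: funext => f; apply: propext; split=> [fTS|].
  have Tspan v : T v -> kspan T (chi v).
    by move=> Tv; rewrite -[chi v]mul1r -(rmorph1 phi); apply: kspan_mono.
  pose I := {v | T v}; have : kspan (fun w => forall i : I, S (sval i + w)) f.
    apply: kspan_forall => // [|[v Tv]]; first by split; exists v0.
    by apply/kspan_shift; rewrite mulrC; apply/fTS/Tspan.
  by apply: kspanS => w Sw v Tv; apply: (Sw (exist _ v Tv)).
move=> fE g; move: g; apply: kspan_ind => [|g h Sg Sh|a w Tw].
- by rewrite mulr0; apply: kspan0.
- by rewrite mulrDr; apply: kspanD.
rewrite mulrC -mulrA; have : kspan S (chi w * f).
  by apply/kspan_shift; apply: kspanS fE => u; apply.
move: (chi w * f); apply: kspan_ind => [|g h Sg Sh|b v Sv].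
- by rewrite mulr0; apply: kspan0.
- by rewrite mulrDr; apply: kspanD.
by rewrite mulrA -rmorphM; apply: kspan_mono.
Qed.

End Characters.

Lemma ge0_shift (x : int) (N : nat) : (`|x| <= N)%N -> 0 <= x + N%:Z.
Proof. lia. Qed.

Section LaurentMonomials.

Variables (k : fieldType) (n : nat).

Local Notation R := {mpoly k[n]}.
Local Notation F := {fraction R}.
Local Notation E := {fraction {poly F}}.
Local Notation Ln := {ffun 'I_n -> int}.

Definition scalarF : {rmorphism k -> F} := (@tofrac R) \o (@mpolyC n k).

Definition xmon (w : Ln) : F := \prod_(i < n) ('X_i : R)%:F ^ w i.

Definition expo (m : 'X_{1..n}) : Ln := [ffun i => (m i)%:Z].

Lemma Xi_neq0 i : ('X_i : R)%:F != 0.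
Proof. by rewrite tofrac_eq0 -msupp_eq0 msuppX. Qed.

Lemma xmon0 : xmon 0 = 1.
Proof. by rewrite /xmon big1 // => i _; rewrite ffunE expr0z. Qed.

Lemma xmonD v w : xmon (v + w) = xmon v * xmon w.
Proof.
rewrite /xmon -big_split; apply: eq_bigr => i _ /=.
by rewrite ffunE expfzDr ?Xi_neq0.
Qed.

Lemma xmon_neq0 w : xmon w != 0.
Proof. by apply/prodf_neq0 => i _; rewrite expfz_neq0 // Xi_neq0. Qed.

Lemma xmon_expo m : xmon (expo m) = ('X_[m] : R)%:F.
Proof.
rewrite mpolyXE_id rmorph_prod /=; apply: eq_bigr => i _.
by rewrite ffunE rmorphXn.
Qed.

Lemma expoD m m' : expo (m + m')%MM = expo m + expo m'.
Proof. by apply/ffunP => i; rewrite !ffunE mnmDE PoszD. Qed.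

Lemma expo_inj : injective expo.
Proof. by move=> m m' /ffunP mm; apply/mnmP => i; have := mm i; rewrite !ffunE => -[]. Qed.

Lemma expoP (w : Ln) : (forall i, 0 <= w i) -> exists m, w = expo m.
Proof.
move=> w0; exists [multinom `|w i|%N | i < n]; apply/ffunP => i.
by rewrite !ffunE mnmE gez0_abs.
Qed.

(** Multiplication by a monomial of high degree turns a relation into one
    between monomials of the polynomial ring. *)
Lemma xmon_free : free_on scalarF xmon (fun _ => True).
Proof.
move=> r _ r0 w; have [wr|] := boolP (has (fun x => x.2 == w) r); last first.
  by move=> wr; rewrite /coef_at big_hasC.
pose N := (\sum_(x <- r) \sum_i `|x.2 i|)%N.
pose e (v : Ln) := [multinom absz (v i + N%:Z)%R | i < n].
have eE x : x \in r -> expo (e x.2) = x.2 + [ffun=> N%:Z].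
  move=> rx; apply/ffunP => i; rewrite !ffunE mnmE gez0_abs // ge0_shift //.
  apply: (@leq_trans (\sum_i `|x.2 i|)%N); first by rewrite (bigD1 i) ?leq_addr.
  by rewrite /N (big_rem _ rx) leq_addr.
have /eqP : (\sum_(x <- r) x.1 *: 'X_[e x.2] : R)%:F = 0.
  rewrite rmorph_sum -[RHS](mul0r (xmon [ffun=> N%:Z])) -[X in _ = X * _]r0.
  rewrite /lin_comb mulr_suml.
  rewrite [LHS]big_seq [RHS]big_seq; apply: eq_bigr => x rx.
  by rewrite -mulrA -xmonD -eE // xmon_expo -mul_mpolyC rmorphM.
rewrite tofrac_eq0 => /eqP/(congr1 (mcoeff (e w))).
rewrite mcoeff0 raddf_sum /= => r1.
transitivity (\sum_(x <- r) (x.1 *: 'X_[e x.2] : R)@_(e w)); last exact: r1.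
rewrite /coef_at big_mkcond.
rewrite [LHS]big_seq [RHS]big_seq; apply: eq_bigr => x rx.
rewrite mcoeffZ mcoeffX; have /hasP[y ry /eqP yw] := wr.
have -> : (e x.2 == e w) = (x.2 == w).
  apply/eqP/eqP => [|->//] /(congr1 expo); rewrite -yw !eE //.
  exact: addIr.
by case: eqP; rewrite ?mulr1 ?mulr0.
Qed.

Lemma tofrac_kspan S (p : R) :
  kspan scalarF xmon S p%:F <-> forall m, m \in msupp p -> S (expo m).
Proof.
pose r := [seq (p@_m, expo m) | m <- msupp p].
have pE : p%:F = lin_comb scalarF xmon r.
  rewrite /lin_comb big_map [in LHS](mpolyE p) rmorph_sum; apply: eq_bigr => m _ /=.
  by rewrite xmon_expo -mul_mpolyC rmorphM.
split=> [[r' Sr' pE'] m pm|Sp]; last first.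
  by exists r => // _ /mapP[m pm ->]; apply: Sp.
apply: (coef_at_supported Sr'); rewrite -(free_coef_at_eq xmon_free (r := r)) //.
  rewrite /coef_at big_map big_mkcond (bigD1_seq m) ?msupp_uniq //= eqxx.
  rewrite big1 ?addr0 -?mcoeff_msupp // => m' mm'.
  by rewrite (inj_eq expo_inj) (negPf mm').
by rewrite -pE.
Qed.

(** The monomial x ^ w * t ^ j has the exponent (j, w). *)
Definition tmon (s : int * Ln) : E := monoE (xmon s.2) s.1.

Definition scalarE : {rmorphism k -> E} :=
  (@tofrac {poly F}) \o (@polyC F) \o scalarF.

Lemma tmonD s t : tmon (s + t) = tmon s * tmon t.
Proof. by rewrite /tmon monoEM xmonD. Qed.

Lemma tmon0 : tmon 0 = 1.
Proof. by rewrite /tmon xmon0 monoE1. Qed.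

(** Multiplication by a power of the variable makes all exponents of it
    nonnegative; its coefficients are then compared in F. *)
Lemma tmon_free : free_on scalarE tmon (fun _ => True).
Proof.
move=> r _ r0 [j w]; have [jr|] := boolP (has (fun x => x.2 == (j, w)) r); last first.
  by move=> jr; rewrite /coef_at big_hasC.
pose N := (\sum_(x <- r) `|x.2.1|)%N.
have NP x : x \in r -> x.2.1 + N%:Z = absz (x.2.1 + N%:Z)%R :> int.
  by move=> rx; rewrite gez0_abs // ge0_shift // /N (big_rem _ rx) leq_addr.
have /eqP : (\sum_(x <- r)
    (scalarF x.1 * xmon x.2.2)%:P * 'X^(absz (x.2.1 + N%:Z)%R))%:F = 0 :> E.
  rewrite rmorph_sum -[RHS](mul0r (monoE 1 N)) -[X in _ = X * _]r0.
  rewrite /lin_comb mulr_suml.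
  rewrite [LHS]big_seq [RHS]big_seq; apply: eq_bigr => x rx.
  rewrite -mulrA monoEM mulr1 NP // /monoE rmorphM rmorphXn polyCM rmorphM /=.
  by rewrite mulrA.
rewrite tofrac_eq0 => /eqP/(congr1 (fun p : {poly F} => p`_(absz (j + N%:Z)%R))).
rewrite coef0 coef_sum => rj.
pose r' := [seq (x.1, x.2.2) | x <- r & x.2.1 == j].
have <- : coef_at r' w = coef_at r (j, w).
  rewrite /coef_at big_map big_filter_cond; apply: eq_bigl => x.
  by case: (x.2) => j' w'.
apply: xmon_free => //; rewrite -[RHS]rj /lin_comb big_map big_filter big_mkcond.
rewrite [LHS]big_seq [RHS]big_seq; apply: eq_bigr => x rx.
rewrite coefCM coefXn; have /hasP[y ry /eqP yj] := jr.
have -> : (absz (j + N%:Z)%R == absz (x.2.1 + N%:Z)%R) = (x.2.1 == j).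
  have := NP _ ry; have := NP _ rx; rewrite yj /=; lia.
by case: eqP; rewrite ?mulr1 ?mulr0.
Qed.

End LaurentMonomials.

(** * Weights modulo M and invariant polynomials *)

Section Congruence.

Variable M : nat.
Implicit Types x y z : int.

Definition congr_mod x y := exists q : int, x = y + q * M%:Z.

Lemma congr_mod_eq x y : (x = y %[mod M])%Z <-> congr_mod x y.
Proof.
split=> [/eqP|[q ->]]; last by rewrite addrC modzMDl.
by rewrite eqz_mod_dvd => /dvdzP[q qE]; exists q; rewrite -qE; ring.
Qed.

Lemma congr_mod_refl x : congr_mod x x.
Proof. by exists 0; ring. Qed.

Lemma congr_mod_sym x y : congr_mod x y -> congr_mod y x.
Proof. by move=> [q ->]; exists (- q); ring. Qed.

Lemma congr_mod_trans y x z : congr_mod x y -> congr_mod y z -> congr_mod x z.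
Proof. by move=> [q ->] [p ->]; exists (q + p); ring. Qed.

Lemma congr_modD x y x' y' :
  congr_mod x y -> congr_mod x' y' -> congr_mod (x + x') (y + y').
Proof. by move=> [q ->] [p ->]; exists (q + p); ring. Qed.

Lemma congr_modN x y : congr_mod x y -> congr_mod (- x) (- y).
Proof. by move=> [q ->]; exists (- q); ring. Qed.

End Congruence.

Section Invariants.

Variables (k : fieldType) (n M : nat) (d : 'I_n -> int).
Hypothesis M_gt0 : (0 < M)%N.

Local Notation R := {mpoly k[n]}.
Local Notation Ln := {ffun 'I_n -> int}.

Definition ext_weight (w : Ln) : int := \sum_(i < n) d i * w i.

Local Notation wt := ext_weight.

Lemma wtD v w : wt (v + w) = wt v + wt w.
Proof. by rewrite /ext_weight -big_split; apply: eq_bigr => i _; rewrite ffunE mulrDr. Qed.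

Lemma wtN w : wt (- w) = - wt w.
Proof. by rewrite /ext_weight -sumrN; apply: eq_bigr => i _; rewrite ffunE mulrN. Qed.

Lemma wt0 : wt 0 = 0.
Proof. by rewrite /ext_weight big1 // => i _; rewrite ffunE mulr0. Qed.

Lemma weightE m : weight d m = wt (expo m).
Proof. by apply: eq_bigr => i _; rewrite ffunE. Qed.

Let N (m : 'X_{1..n}) := (\sum_(i < n) `|(d i %% M)%Z| * m i)%N.

Let N_weight m : congr_mod M (N m) (weight d m).
Proof.
rewrite /N /weight (big_morph Posz PoszD (erefl _)).
apply: (big_ind2 (congr_mod M)) => [|x y x' y' xy xy'|i _].
- exact: congr_mod_refl.
- exact: congr_modD.
rewrite PoszM gez0_abs; last by apply: modz_ge0; move: M_gt0; lia.
exists (- (d i %/ M)%Z * m i); rewrite {2}(divz_eq (d i) M); ring.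
Qed.

Let coactionE (f : R) : coaction M d f =
  \sum_(m <- msupp f) (f@_m *: 'X_[m])%:P * 'X^(N m).
Proof.
apply: eq_bigr => m _; rewrite /= -mul_mpolyC polyCM -mulrA; congr (_ * _).
rewrite /mmap1 mpolyXE_id rmorph_prod /N /=.
rewrite (big_morph _ (exprD 'X) (expr0 'X)) -big_split.
by apply: eq_bigr => i _; rewrite exprMn -exprM rmorphXn.
Qed.

(* The remainder of the coaction modulo 'X^M - 1. *)
Let reduced (f : R) : {poly R} :=
  \sum_(m <- msupp f) (f@_m *: 'X_[m])%:P * 'X^(N m %% M).

Let coaction_reduced (f : R) :
  exists q, coaction M d f - reduced f = q * ('X^M - 1).
Proof.
rewrite coactionE /reduced -sumrB.
apply: (big_ind (fun p => exists q, p = q * ('X^M - 1))) => [|_ _ [p ->] [q ->]|m _].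
- by exists 0; rewrite mul0r.
- by exists (p + q); rewrite mulrDl.
rewrite -mulrBr {1}(divn_eq (N m) M) exprD mulnC exprM -{2}['X^(_ %% _)]mul1r -mulrBl.
by rewrite subrX1; eexists; rewrite [(_ - 1) * _]mulrC mulrAC mulrA.
Qed.

(** Modulo 'X^M - 1 the coaction of f is a polynomial of degree less than M, whose
    coefficients are the parts of f of the various weights modulo M. *)
Lemma mu_invariantP (f : R) :
  mu_invariant M d f <-> forall m, m \in msupp f -> congr_mod M (weight d m) 0.
Proof.
have [q qE] := coaction_reduced f; split=> [[p pE] m0 fm0|f_inv]; last first.
  have gE : reduced f = f%:P.
    rewrite [in RHS](mpolyE f) rmorph_sum /reduced [LHS]big_seq [RHS]big_seq.
    apply: eq_bigr => m /f_inv fm /=.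
    suff -> : (N m %% M = 0)%N by rewrite expr0 mulr1.
    apply/eqP; have [e eE] := congr_mod_trans (N_weight m) fm.
    have /eqP : ((N m)%:Z %% M)%Z = 0 by rewrite eE add0r modzMl.
    by rewrite modz_nat.
  by exists q; rewrite -gE.
have [e e0] : exists e, reduced f = f%:P + e * ('X^M - 1) /\ e = 0.
  exists (p - q); have gE : reduced f = f%:P + (p - q) * ('X^M - 1).
    by rewrite mulrBl -pE -qE; ring.
  split=> //; apply/eqP; apply: contraT => pq0.
  have : (size ((p - q) * ('X^M - 1))%R <= M)%N.
    rewrite (_ : _ * _ = reduced f - f%:P); last by rewrite gE; ring.
    apply: leq_trans (size_polyD _ _) _; rewrite size_polyN geq_max.
    rewrite (leq_trans (size_polyC_leq1 _)) // andbT.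
    apply: leq_trans (size_sum _ _ _) _; apply/bigmax_leqP_seq => m _ _.
    rewrite mul_polyC; apply: leq_trans (size_scale_leq _ _) _.
    by rewrite size_polyXn ltn_mod.
  have szM : size ('X^M - 1 : {poly R}) = M.+1 := size_Xn_sub_1 _ M_gt0.
  have XM0 : 'X^M - 1 != 0 :> {poly R} by rewrite -size_poly_gt0 szM.
  by rewrite size_mul // szM addnS -{2}[M]add0n leq_add2r leqn0 size_poly_eq0 (negPf pq0).
have [gE {}e0] := e0; rewrite {}e0 mul0r addr0 in gE.
have [/eqP Nm0|Nm0] := eqVneq (N m0 %% M)%N 0%N.
  apply: congr_mod_trans (congr_mod_sym (N_weight m0)) _.
  by exists (N m0 %/ M)%N; rewrite {1}(divn_eq (N m0) M) (eqP Nm0) addn0 add0r PoszM.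
move/(congr1 (fun g : {poly R} => g`_(N m0 %% M)%N@_m0)): gE.
rewrite coefC (negPf Nm0) mcoeff0 /reduced coef_sum raddf_sum /=.
rewrite (bigD1_seq m0) ?msupp_uniq //=.
rewrite coefCM coefXn eqxx mulr1 mcoeffZ mcoeffX eqxx mulr1 big1 ?addr0.
  by move/eqP; rewrite mcoeff_eq0 fm0.
move=> m mm0; rewrite coefCM coefXn; case: eqP => _; rewrite ?mulr0 ?mcoeff0 //.
by rewrite mulr1 mcoeffZ mcoeffX (negPf mm0) mulr0.
Qed.

End Invariants.

(** * Divisorial modules on the quotient singularity *)

Section RankOneModulesOverField.

Variables (F : fieldType) (A : F -> Prop).
Implicit Types (N P Q : F -> Prop) (c f g h : F).

Definition fractional_module N :=
  exists g h, [/\ g != 0, h != 0, N g & mdual A N h].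

Lemma hull_rank1_reflexive N : fractional_module N -> hull A N = N ->
  rank1_reflexive A N.
Proof.
move=> [g [h [g0 h0 Ng Nh]]] NE; split; last by move=> f; rewrite NE.
  exists g; split=> // f Nf; exists (h * f), (h * g).
  by split; [exact: Nh|exact: Nh|exact: mulf_neq0|rewrite mulrAC].
by exists h.
Qed.

Lemma misom_scale N P c : c != 0 -> (forall f, N f <-> P (c * f)) -> misom A N P.
Proof.
move=> c0 NP; exists ( *%R c); split=> [f g _ _|a f _ _|f _ /eqP|f|g Pg].
- exact: mulrDr.
- exact: mulrCA.
- by rewrite mulf_eq0 (negPf c0) => /eqP.
- by move/NP.
- by exists (c^-1 * g); rewrite NP mulrA divff // mul1r.
Qed.

(** Comparing the values at f and g after multiplying by an element of the dual
    shows that an isomorphism is the multiplication by a constant. *)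
Lemma misom_scaleP N P : fractional_module N -> misom A N P ->
  exists c, c != 0 /\ forall f, N f <-> P (c * f).
Proof.
move=> [g [h [g0 h0 Ng Nh]]] [phi [phiD phiZ phi_inj phiP phi_surj]].
have phiE f : N f -> phi f = phi g / g * f.
  move=> Nf; apply: (mulfI (mulf_neq0 h0 g0)).
  rewrite -(phiZ _ _ (Nh g Ng) Nf) mulrAC (phiZ _ _ (Nh f Nf) Ng).
  by field.
have c0 : phi g / g != 0.
  by rewrite mulf_neq0 ?invr_eq0 //; apply: contra_neq g0 => /(phi_inj g Ng).
exists (phi g / g); split=> // f.
split=> [Nf|/phi_surj[f' [Nf' f'E]]]; first by rewrite -phiE //; apply: phiP.
suff -> : f = f' by [].
by apply: (mulfI c0); rewrite -f'E phiE.
Qed.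

Lemma misom_scale_right N P Q c : c != 0 ->
  (forall f, P f <-> Q (c * f)) -> misom A N P -> misom A N Q.
Proof.
move=> c0 PQ [phi [phiD phiZ phi_inj phiP phi_surj]].
exists (fun f => c * phi f); split=> [f g Nf Ng|a f Aa Nf|f Nf /eqP|f Nf|g Qg].
- by rewrite phiD // mulrDr.
- by rewrite phiZ // mulrCA.
- by rewrite mulf_eq0 (negPf c0) => /eqP; apply: phi_inj.
- exact/PQ/phiP.
have /phi_surj[f [Nf fE]] : P (c^-1 * g) by apply/PQ; rewrite mulrA divff // mul1r.
by exists f; rewrite fE mulrA divff // mul1r.
Qed.

Lemma misom_scale_left N N' P c : c != 0 ->
  (forall f, N f <-> N' (c * f)) -> misom A N P -> misom A N' P.
Proof.
move=> c0 NN' [phi [phiD phiZ phi_inj phiP phi_surj]].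
have cN f : N' f -> N (c^-1 * f) by move=> N'f; apply/NN'; rewrite mulrA divff // mul1r.
exists (fun f => phi (c^-1 * f)); split=> [f g Nf Ng|a f Aa Nf|f Nf|f Nf|g Qg].
- by rewrite mulrDr phiD //; apply: cN.
- by rewrite mulrCA phiZ //; apply: cN.
- move=> /(phi_inj _ (cN f Nf)) /eqP.
  by rewrite mulf_eq0 invr_eq0 (negPf c0) => /eqP.
- exact/phiP/cN.
have [f [Nf <-]] := phi_surj g Qg; exists (c * f); split; first exact/NN'.
by rewrite mulrA mulVf // mul1r.
Qed.

End RankOneModulesOverField.

Section Slabs.

Variables (k : fieldType) (n M : nat) (d : 'I_n -> int).
Hypotheses (n_gt0 : (0 < n)%N) (M_gt0 : (0 < M)%N).
Hypothesis d_gcd : forall i : 'I_n, \big[gcdn/M]_(j < n | j != i) `|d j|%N = 1%N.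

Local Notation R := {mpoly k[n]}.
Local Notation F := {fraction R}.
Local Notation Ln := {ffun 'I_n -> int}.
Local Notation wt := (ext_weight d).
Local Notation OX := (OX k M d).

Definition unitv (i : 'I_n) : Ln := [ffun j => (j == i)%:Z].

Lemma wt_unitv i : wt (unitv i) = d i.
Proof.
rewrite /ext_weight (bigD1 i) //= ffunE eqxx mulr1 big1 ?addr0 // => j ji.
by rewrite ffunE (negPf ji) mulr0.
Qed.

Lemma wtZ (q : int) w : wt (w *~ q) = wt w * q.
Proof.
by rewrite /ext_weight mulr_suml; apply: eq_bigr => i _; rewrite ffunMzE -mulrzr mulrA intz.
Qed.

(** The integers reached with i-th coordinate 0 form a subgroup containing M
    and all d j with j <> i, hence their gcd. *)
Lemma wt_surj (i : 'I_n) (t : int) : exists w : Ln, w i = 0 /\ congr_mod M (wt w) t.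
Proof.
suff [w [wi [q wE]]] : exists w : Ln, w i = 0 /\ congr_mod M (wt w) 1%N.
  exists (w *~ t); rewrite ffunMzE wi mul0rz wtZ wE; split=> //.
  by exists (q * t); ring.
rewrite -(d_gcd i).
apply: (big_ind (fun x : nat => exists w : Ln, w i = 0 /\ congr_mod M (wt w) x))
    => [|x y [v [vi [p vE]]] [w [wi [q wE]]]|j ji].
- by exists 0; rewrite ffunE wt0; split=> //; exists (-1); ring.
- have [a [b abE]] := Bezoutz x y.
  exists (v *~ a + w *~ b); rewrite ffunE !ffunMzE vi wi !mul0rz addr0; split=> //.
  rewrite wtD !wtZ vE wE; exists (p * a + q * b).
  by rewrite -[(gcdn x y)%:Z]/(gcdz x y) -abE; ring.
have ij : (i == j) = false by rewrite eq_sym (negPf ji).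
have [dj|dj] := leP 0 (d j).
  exists (unitv j); rewrite ffunE ij wt_unitv gez0_abs //.
  by split=> //; apply: congr_mod_refl.
exists (- unitv j); rewrite !ffunE ij wtN wt_unitv ltz0_abs //.
by split=> //; apply: congr_mod_refl.
Qed.

(** The exponents of the monomials in O_X(j) with poles or zeros along the
    coordinate divisors prescribed by a. *)
Definition slab (a : Ln) (j : int) (w : Ln) : Prop :=
  (forall i, a i <= w i) /\ congr_mod M (wt w) j.

Definition slab_module (a : Ln) (j : int) : F -> Prop :=
  kspan (scalarF k n) (@xmon k n) (slab a j).

(** The slab of (a, j) is replaced by a subset that still meets each of its n
    facets, which is enough for the modules spanned by both to have the same dual
    and hence the same reflexive hull. *)
Definition tight (a : Ln) (j : int) (T : Ln -> Prop) :=
  (forall w, T w -> slab a j w) /\ (forall i, exists2 w, T w & w i = a i).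

(** The congruence can be solved with the i-th coordinate prescribed, and adding
    multiples of M to the other coordinates then makes them as large as needed. *)
Lemma slab_tight a j : tight a j (slab a j).
Proof.
clear n_gt0; split=> // i; have [z [zi zE]] := wt_surj i (j - d i * a i).
pose u : Ln := [ffun q => if q == i then a i else (absz (z q) + absz (a q))%N%:Z * M%:Z].
have [s sE] : exists s, wt u = d i * a i + s * M%:Z.
  exists (\sum_(q < n | q != i) d q * (absz (z q) + absz (a q))%N%:Z).
  rewrite /ext_weight (bigD1 i) //= ffunE eqxx mulr_suml; congr (_ + _).
  by apply: eq_bigr => q qi; rewrite ffunE (negPf qi) mulrA.
exists (z + u); last by rewrite !ffunE eqxx zi add0r.
split=> [q|].
  rewrite !ffunE; case: eqP => [->|_]; first by rewrite zi add0r.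
  by move: (z q) (a q) M_gt0 => x y M0; nia.
by case: zE => e zE; exists (e + s); rewrite wtD zE sE; ring.
Qed.

Lemma tight_exists a j T : tight a j T -> exists w, T w.
Proof. by case=> _ /(_ (Ordinal n_gt0))[w Tw _]; exists w. Qed.

Lemma tight_add a j T a' j' T' : tight a j T -> tight a' j' T' ->
  tight (a + a') (j + j') (fun w => exists s t, [/\ T s, T' t & w = s + t]).
Proof.
move=> [Tj Ta] [T'j T'a]; split=> [w [s [t [/Tj[s1 s2] /T'j[t1 t2] ->]]]|i].
  split=> [i|]; first by rewrite !ffunE lerD.
  by rewrite wtD; apply: congr_modD.
have [v Tv vi] := Ta i; have [w T'w wi] := T'a i.
by exists (v + w); [exists v, w | rewrite !ffunE vi wi].
Qed.

Lemma OX_slab : OX = slab_module 0 0.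
Proof.
apply: funext => f; apply: propext; split; move: f.
  move=> _ [g [/(mu_invariantP _ M_gt0) Ig ->]]; apply/tofrac_kspan => m /Ig gm.
  split=> [i|]; first by rewrite !ffunE.
  by rewrite -weightE.
apply: kspan_ind => [|f' g' [f [If ->]] [g [Ig ->]]|a w [w0 wM]].
- by apply: subring0; [apply: OX_1 | apply: OX_B].
- by apply: (subringD (@OX_1 _ _ _ _) (@OX_B _ _ _ _)); [exists f|exists g].
have [m mE] : exists m, w = expo m.
  by apply: expoP => i; have := w0 i; rewrite ffunE.
exists (a *: 'X_[m]); split; last by rewrite mE xmon_expo -mul_mpolyC rmorphM.
apply/mu_invariantP => // m' /msuppZ_le; rewrite msuppX inE => /eqP->.
by rewrite weightE -mE.
Qed.

Lemma OXj_slab j : OXj k M d j = slab_module 0 j.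
Proof.
apply: funext => f; apply: propext; split; move: f.
  apply: aspan_ind => [|f g|_ [a [m [mj ->]]]].
  - exact: kspan0.
  - exact: kspanD.
  apply/tofrac_kspan => m' /msuppZ_le; rewrite msuppX inE => /eqP->.
  split=> [i|]; first by rewrite !ffunE.
  by rewrite -weightE; apply/congr_mod_eq.
apply: kspan_ind => [|f g|a w [w0 wM]].
- exact: aspan0.
- exact: aspanD.
have [m mE] : exists m, w = expo m.
  by apply: expoP => i; have := w0 i; rewrite ffunE.
apply: aspan_id; exists a, m; split; last by rewrite mE xmon_expo -mul_mpolyC rmorphM.
by apply/congr_mod_eq; rewrite weightE -mE.
Qed.

Lemma ideal_D_slab i : ideal_D M d i = slab_module (unitv i) 0.
Proof.
apply: funext => f; apply: propext; split; move: f.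
  move=> _ [g [h [/(mu_invariantP _ M_gt0) Ig gE ->]]].
  apply/tofrac_kspan => m gm; split=> [j|]; last by rewrite -weightE; apply: Ig.
  rewrite !ffunE; case: eqP => // ->.
  move: gm; rewrite gE mulrC (perm_mem (msuppMX _ _)) => /mapP[m' _ ->].
  by rewrite mnmDE mnm1E eqxx; lia.
apply: kspan_ind => [|f' g' [f [h [If fE ->]]] [g [h' [Ig gE ->]]]|a w [w0 wM]].
- exists 0, 0; rewrite mulr0 rmorph0; split=> //.
  by rewrite -mpolyC0; apply: mu_invariantC.
- exists (f + g), (h + h'); split; [|by rewrite mulrDr fE gE|by rewrite tofracD].
  apply/mu_invariantP => // m /msuppD_le; rewrite mem_cat => /orP[] mf.
    exact: (mu_invariantP d M_gt0 f).1.
  exact: (mu_invariantP d M_gt0 g).1.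
have [m mE] : exists m, w - unitv i = expo m.
  by apply: expoP => j; have := w0 j; rewrite !ffunE subr_ge0.
have wE : w = expo (m + U_(i))%MM.
  by rewrite expoD -mE; apply/ffunP => j; rewrite !ffunE mnm1E eq_sym subrK.
exists (a *: 'X_[(m + U_(i))]), (a *: 'X_[m]); split.
- apply/mu_invariantP => // m' /msuppZ_le; rewrite msuppX inE => /eqP->.
  by rewrite weightE -wE.
- by rewrite -scalerAr -mpolyXD addmC.
- by rewrite wE xmon_expo -mul_mpolyC rmorphM.
Qed.

Definition tight_module a j N :=
  exists2 T, tight a j T & N = kspan (scalarF k n) (@xmon k n) T.

Lemma slab_module_tight a j : tight_module a j (slab_module a j).
Proof. by exists (slab a j) => //; apply: slab_tight. Qed.

(** An exponent w translates T into the exponents of regular functions only if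
    a i + w i >= 0, as is seen on the element of T in the i-th facet. *)
Lemma mdual_tight a j N : tight_module a j N -> mdual OX N = slab_module (- a) (- j).
Proof.
move=> [T Ttight ->]; rewrite OX_slab mdual_kspan; first last.
- exact: tight_exists Ttight.
- exact: xmon_free.
- exact: xmonD.
- exact: xmon0.
congr kspan; apply: funext => w; apply: propext; have [Tj Ta] := Ttight.
split=> [wT|[wa wj] v /Tj[va vj]].
  split=> [i|].
    have [v Tv vi] := Ta i; have [/(_ i) + _] := wT v Tv.
    by rewrite !ffunE vi -lerBlDl sub0r.
  have [v Tv] := tight_exists Ttight; have [_ vj] := Tj v Tv.
  have [_] := wT v Tv; rewrite wtD => vw.
  have := congr_modD vw (congr_modN vj).
  by rewrite add0r addrAC subrr add0r.
split=> [i|]; last by rewrite wtD -(subrr j); apply: congr_modD.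
by rewrite !ffunE -lerBlDl sub0r (le_trans _ (wa i)) // ffunE lerN2.
Qed.

Lemma hull_tight a j N : tight_module a j N -> hull OX N = slab_module a j.
Proof.
move=> Na; rewrite /hull (mdual_tight Na) (mdual_tight (slab_module_tight _ _)).
by rewrite !opprK.
Qed.

Lemma mmul_tight a j N a' j' N' : tight_module a j N -> tight_module a' j' N' ->
  tight_module (a + a') (j + j') (mmul N N').
Proof.
move=> [T Ttight ->] [T' T'tight ->]; rewrite mmul_kspan; last exact: xmonD.
by eexists; [apply: tight_add Ttight T'tight|].
Qed.

Lemma OX_tight : tight_module 0 0 OX.
Proof. by rewrite OX_slab; apply: slab_module_tight. Qed.

Lemma iter_mmul_tight a j N m : tight_module a j N ->
  tight_module (a *+ m) (j *+ m) (iter m (mmul N) OX).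
Proof.
move=> Na; elim: m => [|m IHm] /=; first by rewrite !mulr0n; apply: OX_tight.
by rewrite !mulrS; apply: mmul_tight.
Qed.

Lemma mpow_tight a j N (q : int) : tight_module a j N ->
  tight_module (a *~ q) (j * q) (mpow OX N q).
Proof.
move=> Na; rewrite -mulrzz; case: q => m; first exact: iter_mmul_tight.
rewrite /mpow (mdual_tight Na) NegzE !mulrNz -!mulNrz.
exact/iter_mmul_tight/slab_module_tight.
Qed.

Lemma big_mmul_tight (I : Type) (r : seq I) (a : I -> Ln) (j : I -> int) N :
    (forall i, tight_module (a i) (j i) (N i)) ->
  tight_module (\sum_(i <- r) a i) (\sum_(i <- r) j i)
    (\big[@mmul F/OX]_(i <- r) N i).
Proof.
move=> Na; elim: r => [|i r IHr]; first by rewrite !big_nil; apply: OX_tight.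
by rewrite !big_cons; apply: mmul_tight.
Qed.

Lemma OXD_slab m : OXD k M d m = slab_module [ffun i => - m i] 0.
Proof.
rewrite /OXD (hull_tight (big_mmul_tight _ (fun i =>
  mpow_tight (- m i) (eq_ind_r (tight_module _ _) (slab_module_tight _ _) (ideal_D_slab i))))).
congr slab_module; last by rewrite big1 // => i _; rewrite mul0r.
apply/ffunP => q; rewrite sum_ffunE ffunE (bigD1 q) //= ffunMzE ffunE eqxx intz.
by rewrite big1 ?addr0 // => i iq; rewrite ffunMzE ffunE eq_sym (negPf iq) mul0rz.
Qed.

Lemma rtwist_tight a j N q m : tight_module a j N ->
  rtwist M d N q m = slab_module (a *~ q + [ffun i => - m i]) (j * q).
Proof.
move=> Na; rewrite -[j * q]addr0; apply: hull_tight.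
by rewrite OXD_slab; apply/mmul_tight/slab_module_tight/mpow_tight.
Qed.

(** Multiplication by a monomial translates slabs; in particular every slab module
    is isomorphic to one of the O_X(j). *)
Lemma slab_module_scale v a j f :
  slab_module a j f <-> slab_module (a + v) (j + wt v) (@xmon k n v * f).
Proof.
split=> [af|/(kspan_shift _ (@xmon0 k n) (@xmonD k n)) af].
  apply/(kspan_shift _ (@xmon0 k n) (@xmonD k n)); apply: kspanS af => w [aw jw].
  split=> [i|]; first by rewrite !ffunE addrC lerD2l.
  by rewrite wtD addrC; apply: congr_modD => //; apply: congr_mod_refl.
apply: kspanS af => w [aw jw].
split=> [i|]; first by have := aw i; rewrite !ffunE addrC lerD2l.
have := congr_modD jw (congr_mod_refl M (- wt v)).
by rewrite wtD addrAC subrr add0r addrK.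
Qed.

Lemma slab_module_eq a j j' : congr_mod M j j' -> slab_module a j = slab_module a j'.
Proof.
move=> jj'; congr kspan; apply: funext => w; apply: propext.
split=> -[aw wj]; split=> //; first exact: congr_mod_trans jj'.
exact/(congr_mod_trans wj)/congr_mod_sym.
Qed.

Lemma slab_module_neq0 a j : exists2 f, f != 0 & slab_module a j f.
Proof.
have [w Tw] := tight_exists (slab_tight a j); exists (@xmon k n w).
  exact: xmon_neq0.
by rewrite -[xmon _ w]mul1r -(rmorph1 (scalarF k n)); apply: kspan_mono.
Qed.

Lemma slab_module_fractional a j : fractional_module OX (slab_module a j).
Proof.
have [g g0 Ng] := slab_module_neq0 a j.
have [h h0 Nh] := slab_module_neq0 (- a) (- j).
rewrite -(mdual_tight (slab_module_tight a j)) in Nh.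
exact: (ex_intro _ g (ex_intro _ h (And4 g0 h0 Ng Nh))).
Qed.

Lemma slab_module_reflexive a j : rank1_reflexive OX (slab_module a j).
Proof.
exact: (hull_rank1_reflexive (slab_module_fractional a j)
  (hull_tight (slab_module_tight a j))).
Qed.

Lemma slab_module_poly j f : slab_module 0 j f -> exists p : R, f = p%:F.
Proof.
move: f; apply: kspan_ind => [|_ _ [p ->] [q ->]|a w [w0 _]].
- by exists 0; rewrite tofrac0.
- by exists (p + q); rewrite tofracD.
have [m ->] : exists m, w = expo m.
  by apply: expoP => i; have := w0 i; rewrite ffunE.
by exists (a%:MP * 'X_[m]); rewrite xmon_expo tofracM.
Qed.

Lemma mdual_slab_slab j j' c :
  mdual (slab_module 0 j') (slab_module 0 j) c -> slab_module 0 (j' - j) c.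
Proof.
have Tj := slab_tight 0 j; rewrite mdual_kspan; first last.
- exact: tight_exists Tj.
- exact: xmon_free.
- exact: xmonD.
- exact: xmon0.
apply: kspanS => w wj; split=> [i|].
  have [v Tv vi] := Tj.2 i; have [/(_ i) + _] := wj v Tv.
  by rewrite !ffunE vi ffunE add0r.
have [v Tv] := tight_exists Tj; have [_ vj] := Tj.1 v Tv.
have [_] := wj v Tv; rewrite wtD => vw.
by have := congr_modD vw (congr_modN vj); rewrite addrAC subrr add0r.
Qed.

(** The constant of an isomorphism and its inverse are both regular, so that it
    is a unit of the polynomial ring, which is of degree 0. *)
Lemma misom_slab_congr j j' :
  misom OX (slab_module 0 j) (slab_module 0 j') -> congr_mod M j j'.
Proof.
move=> /(misom_scaleP (slab_module_fractional 0 j))[c [c0 cP]].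
have Pc : slab_module 0 (j' - j) c by apply: mdual_slab_slab => f /cP.
have Pc' : slab_module 0 (j - j') c^-1.
  by apply: mdual_slab_slab => f Pf; apply/cP; rewrite mulrA divff // mul1r.
have [p pE] := slab_module_poly Pc; have [q qE] := slab_module_poly Pc'.
have pq : p * q = 1.
  by apply/eqP; rewrite -(@tofrac_eq R) tofracM tofrac1 -pE -qE divff.
have /andP[/eqP p0E _] : p \is a GRing.unit by apply/unitrPr; exists q.
have p0 : p@_0 != 0.
  apply: contra_neq c0 => p0; rewrite pE p0E p0 mpolyC0; exact: tofrac0.
have /(_ 0%MM)[|_] := (tofrac_kspan _ p).1 (eq_ind _ _ Pc _ pE).
  by rewrite mcoeff_msupp.
have -> : expo 0%MM = 0 :> Ln by apply/ffunP => i; rewrite !ffunE mnm0E.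
by rewrite wt0 => -[e eE]; exists e; rewrite -[j]addr0 eE; ring.
Qed.

End Slabs.

(** * The class group *)

Section GradedPolynomials.

Variables (k : fieldType) (n M : nat) (d : 'I_n -> int).

Local Notation R := {mpoly k[n]}.
Implicit Types (p q r s : R) (j : int).

Lemma divisor_msize1 p q : q != 0 -> divides p q -> (msize q <= msize p)%N ->
  exists2 c : k, c != 0 & q = c%:MP * p.
Proof.
move=> q0 [a qE] szpq; move: q0 szpq; rewrite qE mulf_eq0 negb_or => /andP[a0 p0].
rewrite msizeM // => szpq; have /msize_poly1P[c c0 ->] : msize a == 1%N; last by exists c.
move: a0 p0 szpq; rewrite -!msize_poly_eq0.
by move: (msize a) (msize p) => x y; lia.
Qed.

(** An element of least degree of this ideal quotient is a generator, because
    the gcd of two elements is again an element. *)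
Lemma ideal_quotient_principal (I : R -> Prop) p : p != 0 ->
  let J r := forall x, I x -> divides p (r * x) in
  exists r, [/\ r != 0, J r & forall s, J s -> divides r s].
Proof.
move=> p0 J.
have exJ : exists m, `[< exists r, [/\ r != 0, J r & msize r = m] >].
  by exists (msize p); apply/asboolP; exists p; split=> // x _; exists x; rewrite mulrC.
case: (ex_minnP exJ) => m /asboolP[r [r0 Jr <-]] r_min; exists r; split=> // s Js.
have [g [[a rE] [b sE] gP]] := factorial_gcd s (factorial_mpoly r0).
have g0 : g != 0 by apply: contra_neq r0 => g0; rewrite rE g0 mulr0.
have Jg : J g by move=> x Ix; apply: gP; [apply: Jr | apply: Js].
have [||c c0 rgE] := @divisor_msize1 g r r0; first by exists a.
  by apply: r_min; apply/asboolP; exists g.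
exists (b * (c^-1)%:MP); rewrite sE rgE -mulrA [_%:MP * (_ * g)]mulrA -mpolyCM.
by rewrite mulVf // mpolyC1 mul1r.
Qed.

Definition homog_mod j r := forall m, m \in msupp r -> congr_mod M (weight d m) j.

Definition graded_part j r : R :=
  \sum_(m <- msupp r | (weight d m == j %[mod M])%Z) r@_m *: 'X_[m].

Lemma congr_modP x y : reflect (congr_mod M x y) (x == y %[mod M])%Z.
Proof. by apply: (iffP eqP) => /congr_mod_eq. Qed.

Lemma mcoeff_graded_part j r m :
  (graded_part j r)@_m = if (weight d m == j %[mod M])%Z then r@_m else 0.
Proof.
rewrite /graded_part raddf_sum /= big_mkcond.
have [rm|rm] := boolP (m \in msupp r).
  rewrite (bigD1_seq m) ?msupp_uniq //= mcoeffZ mcoeffX eqxx mulr1 big1 ?addr0 //.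
  by move=> m' mm'; rewrite mcoeffZ mcoeffX (negPf mm') mulr0 if_same.
rewrite (memN_msupp_eq0 rm) if_same big1_seq // => m' /= rm'.
by case: eqP rm' rm => // _; rewrite mcoeffZ mcoeffX; case: eqP => [-> ->|_ _ _] //;
  rewrite mulr0.
Qed.

Lemma graded_part_homog j r : homog_mod j (graded_part j r).
Proof.
move=> m; rewrite mcoeff_msupp mcoeff_graded_part.
by case: congr_modP => //; rewrite eqxx.
Qed.

Lemma graded_partD j r s : graded_part j (r + s) = graded_part j r + graded_part j s.
Proof.
apply/mpolyP => m; rewrite mcoeffD !mcoeff_graded_part mcoeffD.
by case: ifP; rewrite ?addr0.
Qed.

Lemma weightD (m m' : 'X_{1..n}) : weight d (m + m')%MM = weight d m + weight d m'.
Proof. by rewrite !weightE expoD wtD. Qed.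

Lemma homog_modM j e r s : homog_mod j r -> homog_mod e s -> homog_mod (j + e) (r * s).
Proof.
move=> rj se m /msuppM_le/allpairsP[[m1 m2] /= [/rj m1j /se m2e ->]].
by rewrite weightD; apply: congr_modD.
Qed.

Lemma graded_part_id j r : homog_mod j r -> graded_part j r = r.
Proof.
move=> rj; apply/mpolyP => m; rewrite mcoeff_graded_part.
case: congr_modP => // mj; apply/esym/eqP; rewrite mcoeff_eq0.
by apply/negP => /rj.
Qed.

Lemma graded_part_eq0 j r :
  (forall m, m \in msupp r -> ~ congr_mod M (weight d m) j) -> graded_part j r = 0.
Proof.
move=> rNj; apply/mpolyP => m; rewrite mcoeff_graded_part mcoeff0.
case: congr_modP => // mj; apply/eqP; rewrite mcoeff_eq0.
by apply/negP => /rNj.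
Qed.

(** The product of p with the parts of s of other weights than j does not contain
    the weight e + j. *)
Lemma graded_partM e p j s : homog_mod e p ->
  graded_part (e + j) (p * s) = p * graded_part j s.
Proof.
move=> pe; rewrite -{1}[s](addrNK (graded_part j s)) mulrDr graded_partD.
rewrite graded_part_eq0 => [|m /msuppM_le/allpairsP[[m1 m2] /= [/pe m1e m2s ->]]].
  rewrite add0r graded_part_id //; apply: homog_modM => //; exact: graded_part_homog.
rewrite weightD => m12; move: m2s; rewrite mcoeff_msupp mcoeffB mcoeff_graded_part.
have m2j : congr_mod M (weight d m2) j.
  case: m12 m1e => a aE [b bE]; exists (a - b).
  by rewrite -(addKr (weight d m1) (weight d m2)) aE bE; ring.
by case: congr_modP; rewrite ?subrr ?eqxx.
Qed.

(** A part of s of weight other than j would contribute a nonzero part of p * s of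
    weight other than e + j. *)
Lemma homog_cancel e p j s : p != 0 -> homog_mod e p ->
  homog_mod (e + j) (p * s) -> homog_mod j s.
Proof.
move=> p0 pe psej m sm.
have : graded_part (weight d m) s != 0.
  apply: contraTneq sm => s0; rewrite mcoeff_msupp negbK.
  have /(congr1 (mcoeff m)) := s0; rewrite mcoeff_graded_part mcoeff0.
  by case: congr_modP => [_ ->|[]]; [rewrite eqxx | apply: congr_mod_refl].
rewrite -(inj_eq (mulfI p0)) mulr0 -(graded_partM _ _ pe).
rewrite -msupp_eq0 => ps0.
have [m' m'ps] : exists m', m' \in msupp (graded_part (e + weight d m) (p * s)).
  by case: (msupp _) ps0 => [//|m' t] _; exists m'; rewrite mem_head.
have := graded_part_homog m'ps; move: m'ps.
rewrite mcoeff_msupp mcoeff_graded_part; case: ifP => [_|]; last by rewrite eqxx.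
rewrite -mcoeff_msupp => /psej[a aE] [b bE]; exists (a - b).
by rewrite -(addKr e (weight d m)) -(addrK (b * M%:Z) (e + _)) -bE aE; ring.
Qed.

(** A graded part of r has at most the degree of r, so that it is a constant
    multiple of r as soon as it is divisible by r. *)
Lemma divides_graded_parts_homog r : r != 0 -> (forall j, divides r (graded_part j r)) ->
  exists j, homog_mod j r.
Proof.
move=> r0 rdiv; have [m rm] : exists m, m \in msupp r.
  by move: r0; rewrite -msupp_eq0; case: (msupp r) => [//|m t] _; exists m; rewrite mem_head.
exists (weight d m); set j := weight d m.
have rjm : (graded_part j r)@_m != 0.
  rewrite mcoeff_graded_part; case: congr_modP => [_|[]]; first by rewrite -mcoeff_msupp.
  exact: congr_mod_refl.
have [||c c0 rjE] := divisor_msize1 _ (rdiv j).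
- by apply: contra_neq rjm => ->; rewrite mcoeff0.
- rewrite !msizeE; apply/bigmax_leqP_seq => m' rm' _.
  apply: (@leq_bigmax_seq _ _ _ (fun m0 : 'X_{1..n} => (mdeg m0).+1)) => //.
  by move: rm'; rewrite !mcoeff_msupp mcoeff_graded_part; case: ifP; rewrite ?eqxx.
move=> m' rm'; apply: (graded_part_homog (r := r)).
by rewrite rjE mcoeff_msupp mcoeffCM mulf_neq0 // -mcoeff_msupp.
Qed.

End GradedPolynomials.

(** Here h * r / p is the generator of a dual module: p = h * g with g in the
    module, and x = h * f with f in the module is such that p divides r * x. *)
Section FieldIdentities.

Variables (K : fieldType) (h r p w f g x z : K).

Lemma dual_generator_eval : h * g = p -> p != 0 -> h * r / p * w * g = r * w.
Proof. by move=> hg p0; apply: (mulIf p0); rewrite -[in RHS]hg; field. Qed.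

Lemma dual_generator_div : p != 0 -> h * f = x -> r * x = z * p ->
  h * r / p * w * f = w * z.
Proof.
move=> p0 <- rx; apply: (mulIf p0); rewrite -[RHS]mulrA -rx; by field.
Qed.

Lemma dual_generator_mul : p != 0 -> r * w * (h * f) = h * r / p * w * f * p.
Proof. by move=> p0; field. Qed.

End FieldIdentities.

Lemma misom_of_dual (F : fieldType) (A P Q : F -> Prop) c : c != 0 ->
    (forall f, P f <-> hull A P f) -> (forall w, Q w <-> mdual A P (c * w)) ->
  misom A P (mdual A Q).
Proof.
move=> c0 PE QE; apply: (misom_scale _ c0) => f; rewrite PE.
split=> [Pf w /QE Qw|Qf e Pe]; first by rewrite mulrAC mulrC; apply: Pf.
have /QE/Qf : mdual A P (c * (c^-1 * e)) by rewrite mulrA divff // mul1r.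
by rewrite mulrACA divff // mul1r.
Qed.

Section ClassGroup.

Variables (k : fieldType) (n M : nat) (d : 'I_n -> int).
Hypotheses (n_gt0 : (0 < n)%N) (M_gt0 : (0 < M)%N).
Hypothesis d_gcd : forall i : 'I_n, \big[gcdn/M]_(j < n | j != i) `|d j|%N = 1%N.

Local Notation R := {mpoly k[n]}.
Local Notation F := {fraction R}.
Local Notation OX := (OX k M d).
Local Notation homog_mod := (homog_mod M d).

Lemma OX_homog (p : R) : OX p%:F <-> homog_mod 0 p.
Proof.
split=> [[q [/(mu_invariantP d M_gt0) Iq /eqP]]|hp].
  by rewrite tofrac_eq => /eqP->.
by exists p; split=> //; apply/mu_invariantP.
Qed.

Lemma slab_homog j (p : R) : slab_module M d 0 j p%:F <-> homog_mod j p.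
Proof.
split=> [/tofrac_kspan pj m /pj[_]|pj]; first by rewrite -weightE.
by apply/tofrac_kspan => m /pj mj; split=> [i|]; rewrite -?weightE ?ffunE.
Qed.

(** Up to scaling by h, N consists of invariant polynomials. Let p be one of them,
    not 0; the polynomials r such that p divides r * x for all x in h * N form a
    principal ideal of the polynomial ring, and its generator r is homogeneous, of some weight
    j, because the ideal is graded. Then the dual of N consists of the products of
    h * r / p with the elements of O_X(- j), and N is the dual of its dual. *)
Theorem reflexive_slab N : rank1_reflexive OX N ->
  exists j, misom OX N (slab_module M d 0 j).
Proof.
move=> [[g [g0 Ng _]] [h [h0 hN]] NE].
pose I (x : R) := exists2 f, N f & h * f = x%:F.
have NI f : N f -> exists2 x, I x & h * f = x%:F.
  by move=> Nf; have [x [_ xE]] := hN f Nf; exists x => //; exists f.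
have I0 x : I x -> homog_mod 0 x.
  by move=> [f Nf fE]; apply/OX_homog; rewrite -fE; apply: hN.
have [p Ip pE] := NI g Ng; have hp := I0 p Ip.
have p0 : p != 0.
  by have := mulf_neq0 h0 g0; rewrite pE tofrac_eq0.
have pF0 : p%:F != 0 by rewrite tofrac_eq0.
have [r [r0 Jr rJ]] := ideal_quotient_principal I p0.
have [j hr] : exists j, homog_mod j r.
  apply: divides_graded_parts_homog => // j; apply: rJ => x Ix.
  have [z zE] := Jr x Ix; exists (graded_part M d j z).
  rewrite [LHS]mulrC -(graded_partM _ _ (I0 x Ix)) [RHS]mulrC -(graded_partM _ _ hp).
  by rewrite mulrC zE mulrC.
exists j; have -> : slab_module M d 0 j = mdual OX (slab_module M d 0 (- j)).
  by rewrite (mdual_tight n_gt0 M_gt0 (slab_module_tight k M_gt0 d_gcd _ _)) opprK oppr0.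
have rF0 : r%:F != 0 by rewrite tofrac_eq0.
have c0 : h * r%:F / p%:F != 0.
  exact: (mulf_neq0 (mulf_neq0 h0 rF0) (invr_neq0 pF0)).
apply: (misom_of_dual c0 NE) => w; split=> [Qw f Nf|dw].
  have [w' wE] := slab_module_poly Qw; rewrite wE in Qw *.
  have [x Ix xE] := NI f Nf; have [z zE] := Jr x Ix.
  have rxF : r%:F * x%:F = z%:F * p%:F by rewrite -!tofracM zE.
  rewrite (dual_generator_div _ pF0 xE rxF) -tofracM.
  apply/OX_homog; rewrite -(addNr j); apply: homog_modM; first exact/slab_homog.
  apply: (homog_cancel p0 hp); rewrite mulrC -zE addrC.
  by apply: homog_modM => //; apply: I0.
have := dw g Ng; rewrite (dual_generator_eval _ _ pE pF0).
move=> [y [/(mu_invariantP d M_gt0) hy yE]].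
have [b bE] : divides r y.
  apply: rJ => x [f Nf fE]; have [u [_ uE]] := dw f Nf; exists u.
  apply/eqP; rewrite -(@tofrac_eq R) !tofracM -yE -fE -uE.
  by apply/eqP; apply: (dual_generator_mul h r%:F w f pF0).
have -> : w = b%:F by apply: (mulfI rF0); rewrite yE bE mulrC tofracM.
apply/slab_homog; apply: (homog_cancel r0 hr).
by rewrite subrr mulrC -bE.
Qed.

End ClassGroup.

(** * Algebras of free monoids are smooth *)

Section UnitPowers.

Variables (C : comPzRingType) (t t' : C).

(** The integer powers of t, for t' the inverse of t. *)
Definition upow (q : int) : C :=
  match q with Posz m => t ^+ m | Negz m => t' ^+ m.+1 end.

Hypothesis tt' : t * t' = 1.

Lemma upowB (a b : nat) : upow (a%:Z - b%:Z) = t ^+ a * t' ^+ b.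
Proof.
elim: a b => [|a IHa] [|b].
- by rewrite subr0 mulr1.
- by rewrite sub0r mul1r.
- by rewrite subr0 mulr1.
rewrite -[in LHS]addn1 -[b.+1]addn1 !PoszD opprD addrACA subrr addr0 IHa.
by rewrite addn1 !exprS mulrACA tt' mul1r.
Qed.

Lemma upowD p q : upow (p + q) = upow p * upow q.
Proof.
have intB (x : int) : exists a b : nat, x = a%:Z - b%:Z.
  by case: x => m; [exists m, 0%N; rewrite subr0 | exists 0%N, m.+1; rewrite sub0r].
have [a [b ->]] := intB p; have [a' [b' ->]] := intB q.
rewrite addrACA -opprD -!PoszD !upowB !exprD; exact: mulrACA.
Qed.

End UnitPowers.

Lemma rmorph_upow (C D : comPzRingType) (f : {rmorphism C -> D}) t t' q :
  f (upow t t' q) = upow (f t) (f t') q.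
Proof. by case: q => m; rewrite /= rmorphXn. Qed.

(** A lift of a unit along a square-zero extension is a unit: if t * t' = 1 + e
    with e of square zero, then the inverse is t' * (1 - e). *)
Lemma lift_unit (C D : comPzRingType) (f : {rmorphism C -> D}) (y y' : D) :
    (forall z, exists x, f x = z) ->
    (forall x z, f x = 0 -> f z = 0 -> x * z = 0) -> y * y' = 1 ->
  exists t t', [/\ t * t' = 1, f t = y & f t' = y'].
Proof.
move=> f_surj f_sq yy'; have [t tE] := f_surj y; have [t' t'E] := f_surj y'.
pose e := t * t' - 1; have fe : f e = 0 by rewrite rmorphB rmorphM rmorph1 tE t'E yy' subrr.
exists t, (t' * (1 - e)); split=> //.
  have -> : t * (t' * (1 - e)) = 1 - e * e by rewrite /e; ring.
  by rewrite f_sq // subr0.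
by rewrite rmorphM rmorphB rmorph1 fe subr0 mulr1.
Qed.

Section FreeMonoidAlgebra.

Variables (k : fieldType) (L : zmodType) (B : comNzRingType).
Variables (phi : {rmorphism k -> B}) (chi : L -> B) (S : L -> Prop).
Hypothesis algS : monoid_algebra phi chi S.

Variables (n : nat) (h : 'I_n -> L) (tau : L) (e : 'I_n -> L -> int) (q : L -> int).
Hypotheses (Sh : forall i, S (h i)) (Stau : S tau) (SNtau : S (- tau)).
Hypothesis eD : forall i s t, e i (s + t) = e i s + e i t.
Hypothesis qD : forall s t, S s -> S t -> q (s + t) = q s + q t.
Hypothesis e_ge0 : forall i s, S s -> 0 <= e i s.
Hypothesis S_dec : forall s, S s -> s = \sum_i h i *~ e i s + tau *~ q s.

(* The coordinates (e, q) identify S with N^n x Z. *)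
Let theta (C : comPzRingType) (y : 'I_n -> C) (t t' : C) (s : L) : C :=
  \prod_i y i ^+ `|e i s|%N * upow t t' (q s).

Let thetaD (C : comPzRingType) (y : 'I_n -> C) t t' : t * t' = 1 ->
  forall s s', S s -> S s' -> theta y t t' (s + s') = theta y t t' s * theta y t t' s'.
Proof.
move=> tt' s s' Ss Ss'; rewrite /theta qD // upowD // mulrACA -big_split /=.
congr (_ * _); apply: eq_bigr => i _; rewrite eD -exprD; congr (_ ^+ _).
by move: (e_ge0 i Ss) (e_ge0 i Ss'); move: (e i s) (e i s') => x z; lia.
Qed.

Let theta0 (C : comPzRingType) (y : 'I_n -> C) t t' : theta y t t' 0 = 1.
Proof.
have S0 := monoid0 algS.
have e0 i : e i 0 = 0 by apply: (addIr (e i 0)); rewrite -eD !add0r.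
have q0 : q 0 = 0 by apply: (addIr (q 0)); rewrite -qD // !add0r.
by rewrite /theta q0 big1 ?mulr1 // => i _; rewrite e0.
Qed.

Let chi_tau : chi tau * chi (- tau) = 1.
Proof. by rewrite -(monoD algS) // subrr (mono0 algS). Qed.

Let chi_theta s : S s -> chi s = theta (chi \o h) (chi tau) (chi (- tau)) s.
Proof.
have [S0 SD chi0 chiD _ _] := algS.
have chiMn x m : S x -> S (x *+ m) /\ chi (x *+ m) = chi x ^+ m.
  move=> Sx; elim: m => [|m [Sm mE]]; first by rewrite mulr0n.
  by rewrite mulrS chiD // mE exprS; split=> //; apply: SD.
have S_tau m : S (tau *~ m) /\ chi (tau *~ m) = upow (chi tau) (chi (- tau)) m.
  case: m => m; first exact: chiMn.
  by rewrite NegzE mulrNz -mulNrz; apply: chiMn.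
have S_sum (r : seq 'I_n) (f : 'I_n -> nat) : S (\sum_(i <- r) h i *+ f i) /\
    chi (\sum_(i <- r) h i *+ f i) = \prod_(i <- r) chi (h i) ^+ f i.
  elim: r => [|i r [Sr rE]]; first by rewrite !big_nil.
  have [Shi hiE] := chiMn _ (f i) (Sh i).
  by rewrite !big_cons chiD // rE hiE; split=> //; apply: SD.
move=> Ss; rewrite {1}(S_dec Ss) /theta.
have -> : \sum_i h i *~ e i s = \sum_i h i *+ `|e i s|%N.
  by apply: eq_bigr => i _; rewrite -{1}(gez0_abs (e_ge0 i Ss)).
have [Ssum sumE] := S_sum (index_enum _) (fun i => `|e i s|%N).
by have [St tE] := S_tau (q s); rewrite chiD // sumE tE.
Qed.

(** A homomorphism from the algebra of N^n x Z is the choice of n elements and a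
    unit, and all of these lift along square-zero extensions. *)
Lemma free_monoid_algebra_smooth : smooth phi.
Proof.
split.
  pose g (i : 'I_(n + 2)) : B := match split i with
    | inl j => chi (h j) | inr j => if j == ord0 then chi tau else chi (- tau) end.
  exists (n + 2)%N, g => y; have := mono_span algS y; move: y.
  apply: kspan_ind => [|_ _ [p ->] [p' ->]|a s Ss].
  - by exists 0; rewrite rmorph0.
  - by exists (p + p'); rewrite rmorphD.
  pose X i : {mpoly k[n + 2]} := 'X_i.
  exists (a%:MP * (\prod_(i < n) X (lshift 2 i) ^+ `|e i s|%N *
    upow (X (rshift n ord0)) (X (rshift n ord_max)) (q s))).
  have gE i : mmap phi g (X i) = g i by rewrite mmapX mmap1U.
  rewrite rmorphM /= mmapC chi_theta // rmorphM rmorph_upow rmorph_prod /= !gE.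
  congr (_ * (_ * _)).
    apply: eq_bigr => i _; rewrite rmorphXn /= gE /g.
    by rewrite (unsplitK (inl i)).
  by rewrite /g (unsplitK (inr ord0)) (unsplitK (inr ord_max)).
move=> C D pi iota u pi_surj pi_sq u_phi.
have [y yE] := choice (fun i => pi_surj (u (chi (h i)))).
have [|t [t' [tt' tE t'E]]] := @lift_unit _ _ pi (u (chi tau)) (u (chi (- tau))) pi_surj pi_sq.
  by rewrite -rmorphM chi_tau rmorph1.
have [v [v_phi v_chi]] := monoid_algebra_hom algS iota (theta0 y t t') (thetaD y tt').
exists v; split=> // b.
apply: (monoid_algebra_hom_eq algS (u := pi \o v)) => [a|s Ss] /=.
  by rewrite v_phi u_phi.
rewrite v_chi // chi_theta // /theta !rmorphM !rmorph_upow !rmorph_prod tE t'E.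
by congr (_ * _); apply: eq_bigr => i _; rewrite !rmorphXn yE.
Qed.

End FreeMonoidAlgebra.

(** * Jets and relations in smooth monoid algebras *)

Section Jets.

Variable k : fieldType.

Local Notation jet N := {poly %/ ('X^(N.+1) : {poly k})}.
Local Notation to_jet N := (in_qpoly ('X^(N.+1) : {poly k})).

Lemma coef_to_jet N (p : {poly k}) i : (i <= N)%N -> (to_jet N p : {poly k})`_i = p`_i.
Proof.
move=> iN; rewrite /= mk_monic_Xn /=.
rewrite [in RHS](Pdiv.RingMonic.rdivp_eq (monicXn k N.+1) p).
by rewrite coefD coefMXn ltnS iN add0r.
Qed.

Lemma jetP N (x y : jet N) :
  (forall i, (i <= N)%N -> (x : {poly k})`_i = (y : {poly k})`_i) -> x = y.
Proof.
move=> xy; apply/val_inj/polyP => i; have [/xy//|Ni] := leqP i N.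
have sz (z : jet N) : (size (z : {poly k}) <= N.+1)%N.
  by rewrite -ltnS; apply: leq_trans (size_mk_monic z) _; rewrite mk_monic_Xn size_polyXn.
by rewrite !nth_default //; apply: leq_trans (sz _) Ni.
Qed.

Lemma to_jetK N (x : jet N) : to_jet N x = x.
Proof. by apply: jetP => i iN; rewrite coef_to_jet. Qed.

Lemma coef_jetM N (x y : jet N) i : (i <= N)%N ->
  ((x * y : jet N) : {poly k})`_i = ((x : {poly k}) * (y : {poly k}))`_i.
Proof. exact: coef_to_jet. Qed.

Definition jet_trunc N (x : jet N.+1) : jet N := to_jet N x.

Lemma jet_trunc_zmod N : zmod_morphism (@jet_trunc N).
Proof. by move=> x y; rewrite /jet_trunc !raddfB. Qed.

Lemma jet_trunc_monoid N : monoid_morphism (@jet_trunc N).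
Proof.
split=> [|x y]; first exact: in_qpoly1.
rewrite /jet_trunc -in_qpolyM; apply: jetP => i iN; rewrite !coef_to_jet //.
exact: ltnW.
Qed.

HB.instance Definition _ N :=
  GRing.isZmodMorphism.Build (jet N.+1) (jet N) (@jet_trunc N) (@jet_trunc_zmod N).
HB.instance Definition _ N :=
  GRing.isMonoidMorphism.Build (jet N.+1) (jet N) (@jet_trunc N) (@jet_trunc_monoid N).

Definition jet_scalar N : {rmorphism k -> jet N} := (to_jet N) \o (@polyC k).

Variables (B : comNzRingType) (phi : {rmorphism k -> B}).

(** The truncations from order N + 1 to order N are square-zero extensions, so that
    a tangent vector lifts to jets of every order. *)
Lemma formally_smooth_jet (u : {rmorphism B -> jet 1}) N : formally_smooth phi ->
    (forall a, u (phi a) = jet_scalar 1 a) ->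
  exists v : {rmorphism B -> jet N.+1}, (forall a, v (phi a) = jet_scalar N.+1 a) /\
    forall b i, (i <= 1)%N -> (v b : {poly k})`_i = (u b : {poly k})`_i.
Proof.
move=> smB u_phi; elim: N => [|N [v [v_phi vE]]]; first by exists u.
have [|||w [wE w_phi]] := smB _ _ (@jet_trunc N.+1 : {rmorphism _ -> _})
    (jet_scalar N.+2) v.
- move=> y; exists (to_jet N.+2 y); apply: jetP => i iN.
  by rewrite !coef_to_jet // ltnW.
- move=> x y x0 y0; apply: jetP => i iN; rewrite coef_jetM // coefM coef0.
  have tr0 (z : jet N.+2) j : jet_trunc z = 0 -> (j <= N.+1)%N -> (z : {poly k})`_j = 0.
    move=> z0 jN; have := congr1 (fun z' : jet N.+1 => (z' : {poly k})`_j) z0.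
    by rewrite coef_to_jet // coef0.
  rewrite big1 // => j _; have [jN|jN] := leqP j N.+1.
    by rewrite (tr0 x) ?mul0r.
  by rewrite (tr0 y) ?mulr0 //; have := ltn_ord j; lia.
- move=> a; rewrite v_phi; apply: jetP => i iN.
  by rewrite !coef_to_jet // ltnW.
exists w; split=> // b i i1; rewrite -vE // -wE coef_to_jet //; lia.
Qed.

End Jets.

Section Relations.

Lemma prod_low_coef0 (k : fieldType) (T : eqType) (s : seq T) (f : T -> {poly k}) m :
    (forall x, x \in s -> forall i, (i < m)%N -> (f x)`_i = 0) ->
  \prod_(x <- s) f x = (\prod_(x <- s) drop_poly m (f x)) * 'X^(m * size s).
Proof.
move=> f0; have -> : 'X^(m * size s) = \prod_(x <- s) 'X^m :> {poly k}.
  by rewrite big_const_seq count_predT iter_mulr_1 exprM.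
rewrite -big_split /= [LHS]big_seq [RHS]big_seq; apply: eq_bigr => x /f0 fx0.
rewrite -{1}(poly_take_drop m (f x)); have -> : take_poly m (f x) = 0.
  by apply/polyP => i; rewrite coef_take_poly coef0; case: ifP => // /fx0.
by rewrite add0r.
Qed.

Variables (k : fieldType) (L : zmodType) (B : comNzRingType).
Variables (phi : {rmorphism k -> B}) (chi : L -> B) (S : L -> Prop).
Hypothesis algS : monoid_algebra phi chi S.

Definition unit_exponent s := S s /\ S (- s).

Lemma unit_exponentD s t : S s -> S t ->
  unit_exponent (s + t) <-> unit_exponent s /\ unit_exponent t.
Proof.
move=> Ss St; have SD := monoidD algS; split=> [[_ SN]|[[_ SNs] [_ SNt]]]; last first.
  by split; rewrite ?opprD; apply: SD.
split; split=> //.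
  have -> : - s = t + - (s + t) by rewrite opprD addrCA subrr addr0.
  exact: SD.
have -> : - t = s + - (s + t) by rewrite opprD addrA subrr add0r.
exact: SD.
Qed.

Variable D : L -> Prop.
Hypotheses (D_nonunit : forall s, D s -> ~ unit_exponent s).
Hypothesis D_irreducible : forall s t, S s -> S t -> D (s + t) ->
  unit_exponent s \/ unit_exponent t.
Hypothesis D_unit : forall s t, unit_exponent s -> S t -> D (s + t) <-> D t.

(* The tangent vector sending D to 1, at the point where all nonunit monomials
   vanish. *)
Let theta (s : L) : {poly k} :=
  (`[< unit_exponent s >])%:R%:P + (`[< D s >])%:R *: 'X.

Let theta_coef0 s : (theta s)`_0 = (`[< unit_exponent s >])%:R.
Proof. by rewrite coefD coefC coefZ coefX mulr0 addr0. Qed.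

Let theta_coef1 s : (theta s)`_1 = (`[< D s >])%:R.
Proof. by rewrite coefD coefC coefZ coefX mulr1 add0r. Qed.

Let thetaD s t : S s -> S t ->
  in_qpoly 'X^2 (theta (s + t)) = in_qpoly 'X^2 (theta s) * in_qpoly 'X^2 (theta t).
Proof.
move=> Ss St; rewrite -in_qpolyM; apply: (@jetP k 1) => i i1.
rewrite !(@coef_to_jet k 1) //.
have UE : `[< unit_exponent (s + t) >] = `[< unit_exponent s >] && `[< unit_exponent t >].
  by rewrite -asbool_and; apply: asbool_equiv_eq; apply: unit_exponentD.
case: i i1 => [|[|//]] _.
  by rewrite coef0M !theta_coef0 UE -mulnb natrM.
rewrite coefM !big_ord_recl big_ord0 /= addr0 !theta_coef0 !theta_coef1.
have DN x : unit_exponent x -> `[< D x >] = false.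
  by move=> Ux; apply/asboolP => /D_nonunit.
have DE x y : unit_exponent x -> S y -> `[< D (x + y) >] = `[< D y >].
  by move=> Ux Sy; apply: asbool_equiv_eq; apply: D_unit.
case: (asboolP (unit_exponent s)) => Us.
  by rewrite DE // (DN s) // mulr1n mulr0n mul0r addr0 mul1r.
case: (asboolP (unit_exponent t)) => Ut.
  by rewrite addrC DE // (DN t) // mulr1n mulr0n mul0r mulr1 add0r.
by case: asboolP => [/(D_irreducible Ss St)[]//|_]; rewrite !mulr0n mul0r mulr0 addr0.
Qed.

Let theta0 : in_qpoly 'X^2 (theta 0) = 1.
Proof.
have U0 : unit_exponent 0 by split; rewrite ?oppr0; apply: monoid0 algS.
rewrite /theta; case: asboolP => // _; case: asboolP => [/D_nonunit//|_].
by rewrite scale0r addr0 in_qpoly1.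
Qed.

(** The tangent vector theta lifts to a jet of order greater than size a. It sends
    the monomials in D to z times a unit and the other nonunit monomials to multiples
    of z ^ 2, so that the sides of the relation have order size a in z and order at
    least 2 * size b. *)
Lemma formally_smooth_relation (a b : seq L) (s : L) : formally_smooth phi ->
    (forall x, x \in a -> S x /\ D x) ->
    (forall x, x \in b -> [/\ S x, ~ unit_exponent x & ~ D x]) ->
    unit_exponent s -> \sum_(x <- a) x = s + \sum_(x <- b) x ->
  (2 * size b <= size a)%N.
Proof.
move=> smB aD bND Us ab; rewrite leqNgt; apply/negP => lt_ab.
have [S0 SD chi0 chiD _ _] := algS.
have [u [u_phi u_chi]] := monoid_algebra_hom algS (jet_scalar k 1) theta0 thetaD.
have [v [_ vE]] := @formally_smooth_jet k B phi u (size a) smB u_phi.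
pose V x : {poly k} := v (chi x).
have V0 x : S x -> (V x)`_0 = (`[< unit_exponent x >])%:R.
  move=> Sx; rewrite /V vE // u_chi // coef_to_jet //.
have V1 x : S x -> (V x)`_1 = (`[< D x >])%:R.
  move=> Sx; rewrite /V vE // u_chi // coef_to_jet //.
have VK x : in_qpoly 'X^((size a).+2) (V x) = v (chi x) := to_jetK _.
have prodV (r : seq L) : (forall x, x \in r -> S x) ->
    S (\sum_(x <- r) x) /\
    v (chi (\sum_(x <- r) x)) = in_qpoly 'X^((size a).+2) (\prod_(x <- r) V x).
  elim: r => [|x r IHr] Sr; first by rewrite !big_nil chi0 rmorph1 in_qpoly1.
  have [|Sr' rE] := IHr; first by move=> y ry; apply: Sr; rewrite inE ry orbT.
  have Sx : S x by apply: Sr; rewrite mem_head.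
  rewrite !big_cons chiD // (rmorphM v) in_qpolyM VK rE; split=> //; exact: SD.
have [x ax|Sa aE] := prodV a; first by case: (aD x ax).
have [x bx|Sb bE] := prodV b; first by case: (bND x bx).
have Ss := Us.1.
have /(congr1 (fun y : {poly %/ 'X^((size a).+2)} => (y : {poly k})`_(size a))) :
    in_qpoly 'X^((size a).+2) (\prod_(x <- a) V x) =
    in_qpoly 'X^((size a).+2) (V s * \prod_(x <- b) V x).
  by rewrite -aE ab chiD // (rmorphM v) bE in_qpolyM VK.
rewrite !coef_to_jet // (prod_low_coef0 (m := 1)) => [|x ax i]; last first.
  have [Sx Dx] := aD x ax; rewrite ltnS leqn0 => /eqP->; rewrite V0 //.
  by case: asboolP => // /(D_nonunit Dx).
rewrite mul1n coefMXn ltnn subnn.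
rewrite [\prod_(x <- b) V x](prod_low_coef0 (m := 2)) => [|x bx i]; last first.
  have [Sx NUx NDx] := bND x bx; case: i => [|[|//]] _; rewrite ?V0 ?V1 //.
    by case: asboolP.
  by case: asboolP.
rewrite mulrA coefMXn lt_ab -horner_coef0 horner_prod big1_seq => [/eqP|x /= ax].
  by rewrite oner_eq0.
have [Sx Dx] := aD x ax; rewrite horner_coef0 coef_drop_poly V1 //.
by case: asboolP.
Qed.

End Relations.

(** * The coordinate ring of the Seifert bundle *)

Section SeifertMonoid.

Variables (k : fieldType) (n M : nat) (d : 'I_n -> int) (l : int).
Variables (b c : 'I_n -> nat).
Hypotheses (n_gt0 : (0 < n)%N) (M_gt0 : (0 < M)%N).
Hypothesis d_gcd : forall i : 'I_n, \big[gcdn/M]_(j < n | j != i) `|d j|%N = 1%N.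
Hypothesis c_gt0 : forall i, (0 < c i)%N.

Local Notation Ln := {ffun 'I_n -> int}.
Local Notation F := {fraction {mpoly k[n]}}.
Local Notation E := {fraction {poly F}}.
Local Notation s := (fun i : 'I_n => (b i)%:R / (c i)%:R : rat).
Local Notation L := (OXj k M d l).
Local Notation B := (seifert_ring M d L s).
Local Notation phi := (seifert_scalar M d L s).

(** The order of vanishing along the divisor of Y over D_i of the monomial
    x ^ w * t ^ j with the exponent (j, w). *)
Definition facet_form (i : 'I_n) (x : int * Ln) : int :=
  (c i)%:Z * x.2 i + (b i)%:Z * x.1.

Local Notation ell := facet_form.

Definition seifert_lattice (x : int * Ln) : Prop := congr_mod M (ext_weight d x.2) (x.1 * l).

Definition seifert_monoid (x : int * Ln) : Prop :=
  (forall i, 0 <= ell i x) /\ seifert_lattice x.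

Lemma ellD i x y : ell i (x + y) = ell i x + ell i y.
Proof. by rewrite /facet_form /= ffunE; ring. Qed.

Lemma ell0 i : ell i 0 = 0.
Proof. by rewrite /facet_form /= ffunE !mulr0 addr0. Qed.

Lemma ellN i x : ell i (- x) = - ell i x.
Proof. by rewrite /facet_form /= ffunE; ring. Qed.

Lemma seifert_latticeD x y :
  seifert_lattice x -> seifert_lattice y -> seifert_lattice (x + y).
Proof. by rewrite /seifert_lattice /= wtD mulrDl; apply: congr_modD. Qed.

Lemma seifert_latticeN x : seifert_lattice x -> seifert_lattice (- x).
Proof. by rewrite /seifert_lattice /= wtN mulNr; apply: congr_modN. Qed.

Lemma seifert_lattice0 : seifert_lattice 0.
Proof. by rewrite /seifert_lattice /= wt0 mul0r; apply: congr_mod_refl. Qed.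

Lemma floor_slope_le (j w : int) i :
  (- Num.floor (j%:~R * ((b i)%:R / (c i)%:R : rat)) <= w) =
  (0 <= (c i)%:Z * w + (b i)%:Z * j).
Proof.
have c0 : 0 < (c i)%:R :> rat by rewrite ltr0n.
rewrite lerNl floor_ge_int mulrA ler_pdivlMr //.
rewrite !pmulrn -!intrM ler_int.
by rewrite mulNr lerNl -subr_ge0 opprK mulrC [j * _]mulrC.
Qed.

Lemma seifert_piece_kspan j : seifert_piece M d L s j =
  kspan (scalarF k n) (@xmon k n) (fun w => seifert_monoid (j, w)).
Proof.
rewrite /seifert_piece OXj_slab.
rewrite (rtwist_tight n_gt0 M_gt0 d_gcd _ _ (slab_module_tight k M_gt0 d_gcd 0 l)).
congr kspan; apply: funext => w; apply: propext.
rewrite /slab /seifert_monoid /seifert_lattice /facet_form /= mulrC mul0rz add0r.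
by split=> -[wa wj]; split=> // i; have := wa i;
  rewrite ffunE floor_slope_le.
Qed.

Lemma seifert_set_kspan :
  seifert_set M d L s = kspan (scalarE k n) (@tmon k n) seifert_monoid.
Proof.
apply: funext => y; apply: propext; split; move: y.
  apply: aspan_ind => [|x y|_ [f [j [+ ->]]]].
  - exact: kspan0.
  - exact: kspanD.
  rewrite seifert_piece_kspan; move: f.
  apply: kspan_ind => [|f g|a w Sw].
  - by rewrite /monoE polyC0 tofrac0 mul0r; apply: kspan0.
  - by rewrite /monoE polyCD tofracD mulrDl; apply: kspanD.
  rewrite /monoE polyCM tofracM -mulrA.
  exact: (kspan_mono (scalarE k n) (@tmon k n) a (Sw : seifert_monoid (j, w))).
apply: kspan_ind => [|x y|a [j w] Sw].
- exact: aspan0.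
- exact: aspanD.
apply: aspan_id; exists (scalarF k n a * @xmon k n w), j; split.
  by rewrite seifert_piece_kspan; apply: kspan_mono.
by rewrite /tmon /monoE polyCM tofracM -mulrA.
Qed.

Definition seifert_mono (x : int * Ln) : B := insubd (0 : B) (@tmon k n x).

Lemma seifert_monoE x : seifert_monoid x -> val (seifert_mono x) = (@tmon k n x).
Proof.
move=> Sx; rewrite val_insubd; case: ifP => // /negP[]; apply/asboolP.
rewrite seifert_set_kspan -[@tmon k n x]mul1r -(rmorph1 (scalarE k n)).
exact: kspan_mono.
Qed.

Lemma val_lin_comb r : supported seifert_monoid r ->
  val (lin_comb phi seifert_mono r) = lin_comb (scalarE k n) (@tmon k n) r.
Proof.
move=> Sr; rewrite /lin_comb raddf_sum [LHS]big_seq [RHS]big_seq.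
apply: eq_bigr => x /Sr Sx; rewrite -seifert_monoE //.
transitivity (val (phi x.1) * val (seifert_mono x.2)); first by [].
congr (_ * _).
by rewrite /= /monoE expr0z mulr1.
Qed.

Lemma seifert_monoid_algebra : monoid_algebra phi seifert_mono seifert_monoid.
Proof.
have S0 : seifert_monoid 0 by split; [move=> i; rewrite ell0 | exact: seifert_lattice0].
have SD x y : seifert_monoid x -> seifert_monoid y -> seifert_monoid (x + y).
  move=> [x0 xL] [y0 yL]; split=> [i|]; last exact: seifert_latticeD.
  by rewrite ellD addr_ge0.
split=> // [|x y Sx Sy|r Sr r0|y].
- by apply: val_inj; rewrite seifert_monoE // tmon0.
- apply: val_inj; rewrite rmorphM /= !seifert_monoE //; first exact: tmonD.
  exact: SD.
- apply: (@tmon_free k n r) => //.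
  by rewrite -val_lin_comb // r0.
- have := asboolP _ (seifert_valP y); rewrite seifert_set_kspan => -[r Sr rE].
  by exists r => //; apply: val_inj; rewrite val_lin_comb.
Qed.

End SeifertMonoid.

(** * Arithmetic of the lattice of exponents *)

Section SeifertLattice.

Variables (n M : nat) (d : 'I_n -> int) (l : int) (b c : 'I_n -> nat).
Hypotheses (n_gt0 : (0 < n)%N) (M_gt0 : (0 < M)%N).
Hypothesis d_gcd : forall i : 'I_n, \big[gcdn/M]_(j < n | j != i) `|d j|%N = 1%N.
Hypothesis c_gt0 : forall i, (0 < c i)%N.
Hypothesis bc_coprime : forall i, coprime (b i) (c i).

Local Notation Ln := {ffun 'I_n -> int}.
Local Notation Lambda := (seifert_lattice M d l).
Local Notation ell := (facet_form b c).
Implicit Types (x y : int * Ln).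

(** The facet forms map the lattice onto Z^n. *)
Definition facet_basis := forall i, exists2 x, Lambda x & forall j, ell j x = (j == i)%:Z.

Let C := (\prod_(i < n) c i)%N.

(** A representative of the multiple of the Chern class by the product of the
    c i, under the isomorphism of the class group with Z / M. *)
Definition chern_residue : int :=
  l * (\prod_(i < n) c i)%N%:Z +
  \sum_(i < n) d i * ((\prod_(j < n | j != i) c j) * b i)%N%:Z.

(** The primitive exponent of a Laurent monomial without zeros or poles on the
    boundary, if the c i are pairwise coprime. *)
Definition kernel_vector : int * Ln :=
  ((\prod_(i < n) c i)%N%:Z, [ffun i => - ((\prod_(j < n | j != i) c j) * b i)%N%:Z]).

Let CE i : C = (c i * \prod_(j < n | j != i) c j)%N.
Proof. by rewrite /C (bigD1 i). Qed.

Lemma ell_kernel_vector i : ell i kernel_vector = 0.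
Proof. by rewrite /facet_form /= ffunE -/C (CE i) !PoszM; ring. Qed.

Lemma ellMz i x (q : int) : ell i (x *~ q) = ell i x * q.
Proof.
have zmodE : {morph ell i : u v / u - v} by move=> u v; rewrite ellD ellN.
pose f : {additive (int * Ln)%type -> int} :=
  HB.pack (ell i) (GRing.isZmodMorphism.Build _ _ (ell i) zmodE).
by rewrite -[LHS]/(f _) raddfMz -mulrzr intz.
Qed.

(* Lambda is the set where the defect vanishes modulo M. *)
Let defect x : int := x.1 * l - ext_weight d x.2.

Let defectP x : Lambda x <-> congr_mod M (defect x) 0.
Proof.
rewrite /seifert_lattice /defect; split=> -[q qE].
  by exists (- q); rewrite qE; ring.
by exists (- q); rewrite -(subKr (x.1 * l) (ext_weight d x.2)) qE; ring.
Qed.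

Let defectD x y : defect (x + y) = defect x + defect y.
Proof. by rewrite /defect /= wtD; ring. Qed.

Let fstMz x (q : int) : (x *~ q).1 = x.1 * q.
Proof. by rewrite (raddfMz fst) -mulrzz. Qed.

Let sndMz x (q : int) : (x *~ q).2 = x.2 *~ q.
Proof. exact: (raddfMz snd). Qed.

Let defectMz x (q : int) : defect (x *~ q) = defect x * q.
Proof. by rewrite /defect fstMz sndMz wtZ; ring. Qed.

Let defect_kernel_vector : defect kernel_vector = chern_residue.
Proof.
rewrite /defect /chern_residue /= mulrC; congr (_ + _).
by rewrite /ext_weight -sumrN; apply: eq_bigr => i _; rewrite ffunE mulrN opprK.
Qed.

Lemma ell_eq0_dvd i x : ell i x = 0 -> (c i %| x.1)%Z.
Proof.
move=> xi; rewrite -(@Gauss_dvdzr _ (b i)); last first.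
  by rewrite coprimezE /= coprime_sym.
apply/dvdzP; exists (- x.2 i); move/eqP: xi.
by rewrite /facet_form addrC addr_eq0 => /eqP->; ring.
Qed.

(** If all facet forms vanish, each c i divides the exponent of t. *)
Lemma kernel_vectorP x : (forall i j, i != j -> coprime (c i) (c j)) ->
  (forall i, ell i x = 0) -> exists q, x = kernel_vector *~ q.
Proof.
move=> c_coprime x0.
have : (C%:Z %| x.1)%Z.
  rewrite dvdzE /C; elim: (index_enum _) (index_enum_uniq 'I_n) => [|i r IHr] /=.
    by rewrite big_nil dvd1n.
  move=> /andP[ir r_uniq]; rewrite big_cons Gauss_dvd; last first.
    rewrite big_seq; elim/big_ind: _ => [|p q|j jr]; first exact: coprimen1.
      by rewrite coprimeMr => -> ->.
    by apply: c_coprime; apply: contraNneq ir => ->.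
  by rewrite IHr // andbT; apply: ell_eq0_dvd.
case/dvdzP=> q qE; exists q.
apply/eqP; rewrite -pair_eqE /pair_eq fstMz sndMz /= qE mulrC eqxx /=.
apply/eqP/ffunP => i; rewrite ffunMzE ffunE.
have ci0 : (c i)%:Z != 0 by rewrite eqz_nat -lt0n.
apply: (mulfI ci0); have := x0 i; rewrite /facet_form qE (CE i) !PoszM => /eqP.
by rewrite addr_eq0 -mulrzr intz => /eqP->; ring.
Qed.

Lemma kernel_vector_lattice q :
  Lambda (kernel_vector *~ q) <-> congr_mod M (chern_residue * q) 0.
Proof. by rewrite defectP defectMz defect_kernel_vector. Qed.

(** On the vector dual to the i-th facet, c j divides the exponent of t for all
    j <> i, while the i-th form takes the value 1. *)
Lemma facet_basis_coprime : facet_basis -> forall i j, i != j -> coprime (c i) (c j).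
Proof.
move=> basis i j ij; have [x _ xE] := basis i.
have /dvdzP[y yE] : (c j %| x.1)%Z by apply: ell_eq0_dvd; rewrite xE eq_sym (negPf ij).
have := xE i; rewrite eqxx /facet_form yE => e.
change (is_true (coprimez (c i) (c j))); apply/coprimezP.
by exists (x.2 i, (b i)%:Z * y); rewrite /= -[RHS]e; ring.
Qed.

(** The multiple by c j of the vector dual to the j-th facet differs from the
    exponent of x_j by a multiple of the kernel vector, which gives d j as a
    multiple of the residue; the gcd of M and the d j is 1. *)
Lemma facet_basis_chern : facet_basis -> coprimez chern_residue M%:Z.
Proof.
move=> basis; have c_coprime := facet_basis_coprime basis.
pose K (t : nat) := exists q : int, congr_mod M t (chern_residue * q).
suff [q [p pE]] : K 1%N.
  by apply/coprimezP; exists (q, p); rewrite /= [RHS]pE; ring.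
have Kd j : exists q : int, congr_mod M (d j) (chern_residue * q).
  have [h hL hE] := basis j.
  have [i|q qE] := @kernel_vectorP (h *~ (c j)%:Z - (0, unitv j)) c_coprime.
    rewrite ellD ellN ellMz hE /facet_form /= ffunE.
    by case: eqP => [->|_] /=; ring.
  exists q; rewrite -defect_kernel_vector -defectMz -qE.
  rewrite defectD defectMz -mulrN1z defectMz /defect /= mul0r wt_unitv.
  move/defectP: hL => [e eE]; exists (- (e * (c j)%:Z)).
  by rewrite -/(defect h) eE; ring.
rewrite -(d_gcd (Ordinal n_gt0)).
apply: (big_ind K) => [|t t' [q [e eE]] [q' [e' e'E]]|j _].
- by exists 0, 1; rewrite mulr0 add0r mul1r.
- have [u [v uv]] := Bezoutz t t'.
  exists (q * u + q' * v), (e * u + e' * v).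
  by rewrite -[(gcdn t t')%:Z]/(gcdz t t') -uv eE e'E; ring.
have [q qE] := Kd j; have [dj|dj] := leP 0 (d j).
  by exists q; rewrite gez0_abs.
by exists (- q); rewrite ltz0_abs // mulrN; apply: congr_modN.
Qed.

(** The Chinese remainder theorem gives an integral vector dual to the i-th facet;
    adding a multiple of the kernel vector, whose defect is a unit modulo M, moves it
    into the lattice. *)
Lemma coprime_facet_basis : (forall i j, i != j -> coprime (c i) (c j)) ->
  coprimez chern_residue M%:Z -> facet_basis.
Proof.
move=> c_coprime /coprimezP[[r' M'] /= rM] i.
pose P := (\prod_(j < n | j != i) c j)%N.
have /coprimezP[[u v] /= uv] : coprimez (b i * P)%N (c i).
  rewrite coprimezE /= coprimeMl bc_coprime /P /=.
  elim/big_ind: _ => [|p q|j ji]; first exact: coprime1n.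
    by rewrite coprimeMl => -> ->.
  exact: c_coprime.
pose t : int * Ln := (u * P%:Z, [ffun j => if j == i then v else
  - ((b j)%:Z * u * (\prod_(q < n | (q != i) && (q != j)) c q)%N%:Z)]).
exists (t + kernel_vector *~ (- (defect t * r'))) => [|j].
  apply/defectP; rewrite defectD defectMz defect_kernel_vector.
  exists (defect t * M'); rewrite -[X in X + _]mulr1 -rM; ring.
rewrite ellD ellMz ell_kernel_vector mul0r addr0 /facet_form /= ffunE.
case: eqP => [->|/eqP ji]; first by rewrite -[RHS]uv PoszM; ring.
have -> : P = (c j * \prod_(q < n | (q != i) && (q != j)) c q)%N by rewrite /P (bigD1 j).
by rewrite PoszM /=; ring.
Qed.

End SeifertLattice.

(** * Smoothness in terms of the lattice of exponents *)

Lemma ge0_shift_mul (x : int) (t : nat) : (0 < t)%N -> 0 <= x + t%:Z * `|x|%N%:Z.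
Proof.
by move=> t0; have : `|x|%N%:Z <= t%:Z * `|x|%N%:Z; [rewrite -PoszM lez_nat leq_pmull|lia].
Qed.

Section MonoidSmoothness.

Variables (k : fieldType) (n M : nat) (d : 'I_n -> int) (l : int) (b c : 'I_n -> nat).
Hypothesis M_gt0 : (0 < M)%N.
Hypothesis d_gcd : forall i : 'I_n, \big[gcdn/M]_(j < n | j != i) `|d j|%N = 1%N.
Hypothesis c_gt0 : forall i, (0 < c i)%N.
Hypothesis bc_coprime : forall i, coprime (b i) (c i).

Local Notation Ln := {ffun 'I_n -> int}.
Local Notation Lambda := (seifert_lattice M d l).
Local Notation S := (seifert_monoid M d l b c).
Local Notation ell := (facet_form b c).
Implicit Types (x y : int * Ln).

Variables (B : comNzRingType) (phi : {rmorphism k -> B}) (chi : int * Ln -> B).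
Hypothesis algS : monoid_algebra phi chi S.

Lemma unit_exponentP x : unit_exponent S x <-> Lambda x /\ forall i, ell i x = 0.
Proof.
split=> [[[x0 xL] [xN _]]|[xL x0]].
  split=> // i; apply/eqP; rewrite eq_le x0 andbT.
  by have := xN i; rewrite ellN oppr_ge0.
split; split=> [i|].
- by rewrite x0.
- exact: xL.
- by rewrite ellN x0 oppr0.
- exact: seifert_latticeN.
Qed.

(** Some multiple of the j-th coordinate vector is in the image of the lattice,
    because the exponent of the invariant monomial x_j ^ M is in the lattice. *)
Let minimal_axis_vector j : exists a x, [/\ (0 < a)%N, Lambda x,
    forall i, ell i x = a%:Z * (i == j)%:Z &
    forall y (t : nat), Lambda y -> (0 < t)%N ->
      (forall i, ell i y = t%:Z * (i == j)%:Z) -> (a <= t)%N].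
Proof.
pose Q (t : nat) := (0 < t)%N /\ exists2 x, Lambda x &
  forall i, ell i x = t%:Z * (i == j)%:Z.
have Qc : Q (M * c j)%N.
  split; first by rewrite muln_gt0 M_gt0 c_gt0.
  exists (0, unitv j *~ M%:Z).
    by exists (d j); rewrite /= wtZ wt_unitv; ring.
  move=> i; rewrite /facet_form /= ffunMzE ffunE -mulrzr intz PoszM.
  by case: eqP => [->|_] /=; ring.
have exQ : exists t, `[< Q t >] by exists (M * c j)%N; apply/asboolP.
case: (ex_minnP exQ) => a /asboolP[a0 [x xL xE]] a_min; exists a, x; split=> // y t yL t0 yE.
by apply: a_min; apply/asboolP; split=> //; exists y.
Qed.

Let total x := (\sum_i `|ell i x|)%N.

Let totalD x y : S x -> S y -> total (x + y) = (total x + total y)%N.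
Proof.
move=> [x0 _] [y0 _]; rewrite /total -big_split; apply: eq_bigr => i _ /=.
by rewrite ellD; move: (x0 i) (y0 i); move: (ell i x) (ell i y) => p q; lia.
Qed.

Let total_eq0 x : S x -> total x = 0%N -> unit_exponent S x.
Proof.
move=> [x0 xL] /eqP; rewrite sum_nat_eq0 => /forallP t0.
by apply/unit_exponentP; split=> // i; apply/eqP; rewrite -absz_eq0 (implyP (t0 i)).
Qed.

Let minimal_transversal i : exists x, [/\ S x, ell i x = 1 &
  forall y, S y -> ell i y = 1 -> (total x <= total y)%N].
Proof.
suff exS : exists t, `[< exists2 x, S x & ell i x = 1 /\ total x = t >].
  case: (ex_minnP exS) => t /asboolP[x Sx [xi xt]] t_min; exists x; split=> // y Sy yi.
  by rewrite xt; apply: t_min; apply/asboolP; exists y.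
have /coprimezP[[u v] /= uv] : coprimez (b i) (c i) := bc_coprime i.
have [w [wi wE]] := wt_surj d_gcd i (u * l - d i * v).
(* A multiple of M added to a coordinate keeps the congruence; the multiplier N j
   outweighs a negative value of the j-th form. *)
pose N j := (absz (ell j (u, w)))%N.
pose z : Ln := [ffun j => if j == i then v else w j + (N j)%:Z * M%:Z].
exists (total (u, z)); apply/asboolP; exists (u, z); split=> //; first last.
- by rewrite /facet_form /= ffunE eqxx -[RHS]uv; ring.
- have -> : z = w + (unitv i *~ v + \sum_(j < n | j != i) unitv j *~ (N j * M)%N%:Z).
    apply/ffunP => j; rewrite !ffunE ffunMzE ffunE sum_ffunE.
    have [->|ji] := eqVneq j i.
      rewrite wi add0r intz big1 ?addr0 // => q qi.
      by rewrite ffunMzE ffunE eq_sym (negPf qi) mul0rz.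
    rewrite mul0rz add0r (bigD1 j) //= ffunMzE ffunE eqxx intz big1 ?addr0 ?PoszM //.
    by move=> q /andP[_ qj]; rewrite ffunMzE ffunE eq_sym (negPf qj) mul0rz.
  rewrite /seifert_lattice /= !wtD wtZ wt_unitv (big_morph _ (@wtD n d) (@wt0 n d)).
  have [q qE] := wE.
  exists (q + \sum_(j < n | j != i) d j * (N j)%:Z); rewrite qE mulrDl mulr_suml.
  rewrite (eq_bigr (fun j => d j * (N j)%:Z * M%:Z)) => [|j _]; first by ring.
  by rewrite wtZ wt_unitv PoszM mulrA.
move=> j; rewrite /facet_form /= ffunE; case: eqP => [->|_].
  have -> : (c i)%:Z * v + (b i)%:Z * u = 1 by rewrite -uv; ring.
  by [].
have -> : (c j)%:Z * (w j + (N j)%:Z * M%:Z) + (b j)%:Z * u =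
    ell j (u, w) + (c j)%:Z * M%:Z * (N j)%:Z by rewrite /facet_form /=; ring.
by rewrite -PoszM ge0_shift_mul // muln_gt0 c_gt0.
Qed.

(** Let h j be an element of S on which the j-th facet form takes the least possible
    value a j > 0 and all others vanish, and suppose that a i > 1. An element g of S
    with i-th form 1 and least total is, like the h j, irreducible modulo the units,
    and a multiple of g is, up to a unit, a sum of copies of the h j. Jets for which
    g has order 1 and the h j have order at least 2 give one bound on the numbers
    of summands on the two sides, and jets for which the roles are exchanged give the
    opposite bound; they exclude each other. *)
Lemma smooth_facet_basis : formally_smooth phi -> facet_basis M d l b c.
Proof.
move=> smB i; have [a ahP] := choice minimal_axis_vector.
have {ahP}[h ahP] := choice ahP.
suff ai : a i = 1%N.
  by have [_ hL hE _] := ahP i; exists (h i) => // j; rewrite hE ai mul1r.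
have a0 j : (0 < a j)%N by case: (ahP j).
have hE j q : ell q (h j) = (a j)%:Z * (q == j)%:Z by case: (ahP j).
have Sh j : S (h j).
  by have [_ hL _ _] := ahP j; split=> // q; rewrite hE mulr_ge0.
have hNU j : ~ unit_exponent S (h j).
  move=> /unit_exponentP[_ /(_ j)]; rewrite hE eqxx mulr1 => aj.
  by have := a0 j; rewrite -ltz_nat aj.
have [g [Sg gi g_min]] := minimal_transversal i.
have gNU : ~ unit_exponent S g by move=> /unit_exponentP[_ /(_ i)]; rewrite gi.
apply/eqP; rewrite eqn_leq a0 andbT leqNgt; apply/negP => ai.
pose A := (\prod_j a j)%N; have A0 : (0 < A)%N by rewrite prodn_gt0.
(* On both A g and the sum of the e j h j the j-th form is A times its value
   on g. *)
pose e j := (\prod_(q < n | q != j) a q * `|ell j g|)%N.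
pose alpha := nseq A g; pose beta := flatten [seq nseq (e j) (h j) | j <- index_enum 'I_n].
have sum_alpha : \sum_(x <- alpha) x = g *+ A by rewrite big_nseq iter_addr_0.
have sum_beta : \sum_(x <- beta) x = \sum_j h j *+ e j.
  rewrite big_flatten /= big_map; apply: eq_bigr => j _.
  by rewrite big_nseq iter_addr_0.
have betaP x : x \in beta -> exists j, x = h j.
  by case/flattenP=> _ /mapP[j _ ->]; rewrite mem_nseq => /andP[_ /eqP->]; exists j.
have alphaP x : x \in alpha -> x = g by rewrite mem_nseq => /andP[_ /eqP].
have ellMn j x t : ell j (x *+ t) = ell j x *+ t.
  by elim: t => [|t IHt]; rewrite ?mulr0n ?ell0 // !mulrS ellD IHt.
pose kappa := \sum_(x <- alpha) x - \sum_(x <- beta) x.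
have latticeMn x t : Lambda x -> Lambda (x *+ t).
  move=> xL; elim: t => [|t IHt]; first by rewrite mulr0n; apply: seifert_lattice0.
  by rewrite mulrS; apply: seifert_latticeD.
have kappaU : unit_exponent S kappa.
  apply/unit_exponentP; split.
    apply: seifert_latticeD; first by rewrite sum_alpha; apply: latticeMn; have [] := Sg.
    apply: seifert_latticeN; rewrite sum_beta.
    apply: (big_ind (seifert_lattice M d l)) => [||j _];
      [exact: seifert_lattice0|exact: seifert_latticeD|].
    by apply: latticeMn; have [] := Sh j.
  move=> j; rewrite ellD ellN sum_alpha sum_beta ellMn.
  rewrite (big_morph (ell j) (ellD b c j) (ell0 b c j)) (bigD1 j) //=.
  rewrite ellMn hE eqxx mulr1 big1 ?addr0 => [|q qj]; last first.
    by rewrite ellMn hE eq_sym (negPf qj) mulr0 mul0rn.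
  have mulrnE (x : int) (t : nat) : x *+ t = x * t%:Z by rewrite -mulr_natr natz.
  rewrite !mulrnE /e /A (bigD1 j) //= !PoszM gez0_abs; last by have [] := Sg.
  by ring.
have kappaNU : unit_exponent S (- kappa) by split; rewrite ?opprK; case: kappaU.
have unitD x y : unit_exponent S x -> forall j, ell j (x + y) = ell j y.
  by move=> /unit_exponentP[_ x0] j; rewrite ellD x0 add0r.
pose D1 x := forall j, ell j x = ell j g.
pose D2 x := exists j, forall q, ell q x = (a j)%:Z * (q == j)%:Z.
have le1 : (2 * size beta <= size alpha)%N.
  apply: (@formally_smooth_relation k _ B phi chi S algS D1 _ _ _ alpha beta kappa) => //.
  - by move=> x xg /unit_exponentP[_ /(_ i)]; rewrite xg gi.
  - move=> x y Sx Sy xyg; have x0 := Sx.1 i; have y0 := Sy.1 i.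
    have txy : total (x + y) = total g.
      by rewrite /total; apply: eq_bigr => j _; rewrite xyg.
    rewrite totalD // in txy; have := xyg i; rewrite ellD gi => xyi.
    have [xi|xi] : ell i x = 1 \/ ell i y = 1.
      by move: xyi x0 y0; move: (ell i x) (ell i y) => p q; lia.
    + by right; apply: total_eq0 => //; have := g_min x Sx xi; lia.
    + by left; apply: total_eq0 => //; have := g_min y Sy xi; lia.
  - by move=> x y xU Sy; split=> yg j; have := yg j; rewrite unitD.
  - by move=> x /alphaP->.
  - move=> x /betaP[j ->]; split=> // /(_ i); rewrite hE gi.
    by case: eqP => [<-|_]; rewrite ?mulr0 // mulr1 => -[a1]; rewrite a1 in ai.
  - by rewrite /kappa subrK.
have le2 : (2 * size alpha <= size beta)%N.
  apply: (@formally_smooth_relation k _ B phi chi S algS D2 _ _ _ beta alpha (- kappa)) => //.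
  - by move=> x [j xE] /unit_exponentP[_ /(_ j)]; rewrite xE eqxx mulr1 => -[aj];
      have := a0 j; rewrite aj.
  - move=> x y Sx Sy [j xyE].
    have xy0 q : q != j -> ell q x = 0 /\ ell q y = 0.
      move=> qj; have := xyE q; rewrite ellD (negPf qj) mulr0.
      by move: (Sx.1 q) (Sy.1 q); move: (ell q x) (ell q y) => p r; lia.
    have xyj : ell j x + ell j y = (a j)%:Z by rewrite -ellD xyE eqxx mulr1.
    have [xj|xj] := eqVneq (ell j x) 0.
      left; apply/unit_exponentP; split=> [|q]; first by case: Sx.
      by have [->//|/xy0[]] := eqVneq q j.
    have xE q : ell q x = `|ell j x|%N%:Z * (q == j)%:Z.
      have [->|/[dup] /xy0[-> _] _] := eqVneq q j; last by rewrite mulr0.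
      by rewrite mulr1 gez0_abs //; case: Sx.
    have [_ _ _ a_min] := ahP j.
    have le_a := a_min x _ Sx.2 _ xE; rewrite absz_gt0 in le_a.
    right; apply/unit_exponentP; split=> [|q]; first by case: Sy.
    have [->|/xy0[]//] := eqVneq q j.
    move: (Sx.1 j) (Sy.1 j) xyj (le_a xj).
    by move: (ell j x) (ell j y) => p r; lia.
  - move=> x y xU Sy; split=> -[j yE]; exists j => q; have := yE q; by rewrite unitD.
  - by move=> x /betaP[j ->]; split=> //; exists j => q; apply: hE.
  - move=> x /alphaP->; split=> // -[j gE]; have := gE i; rewrite gi.
    by case: eqP => [<-|_]; rewrite ?mulr0 // mulr1 => -[a1]; rewrite -a1 in ai.
  - by rewrite /kappa opprB subrK.
by have := size_nseq A g; rewrite -/alpha; lia.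
Qed.

Hypothesis n_gt0 : (0 < n)%N.

(** Subtracting from an element of the lattice the combination of the h i with the
    same values of the facet forms leaves a multiple of the kernel vector; it lies in
    the lattice, hence is a multiple of tau. *)
Lemma facet_basis_smooth : facet_basis M d l b c -> smooth phi.
Proof.
move=> basis; have c_coprime := facet_basis_coprime bc_coprime basis.
have chern := facet_basis_chern n_gt0 d_gcd c_gt0 bc_coprime basis.
have hex i : exists x, Lambda x /\ forall j, ell j x = (j == i)%:Z.
  by have [x xL xE] := basis i; exists x.
have {hex}[h hP] := choice hex.
pose tau := kernel_vector b c *~ M%:Z.
have ell_tau i : ell i tau = 0 by rewrite ellMz ell_kernel_vector mul0r.
have tauL : Lambda tau by apply/kernel_vector_lattice; exists (chern_residue d l b c); ring.
have [Stau SNtau] : unit_exponent S tau by apply/unit_exponentP.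
have Sh i : S (h i).
  by have [hL hE] := hP i; split=> // j; rewrite hE.
pose r x := x - \sum_i h i *~ ell i x.
have rD x y : r (x + y) = r x + r y.
  rewrite /r; have -> : \sum_i h i *~ ell i (x + y) =
      \sum_i h i *~ ell i x + \sum_i h i *~ ell i y.
    by rewrite -big_split; apply: eq_bigr => i _; rewrite ellD mulrzDr.
  by rewrite opprD addrACA.
have latticeMz x (p : int) : Lambda x -> Lambda (x *~ p).
  move=> xL; have LMn m : Lambda (x *+ m).
    elim: m => [|m IHm]; first by rewrite mulr0n; apply: seifert_lattice0.
    by rewrite mulrS; apply: seifert_latticeD.
  by case: p => m; [apply: LMn | rewrite NegzE mulrNz; apply/seifert_latticeN/LMn].
have r_tau x : Lambda x -> exists p, r x = tau *~ p.
  move=> xL; have rL : Lambda (r x).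
    apply: seifert_latticeD => //; apply: seifert_latticeN.
    apply: (big_ind (seifert_lattice M d l)) => [||i _];
      [exact: seifert_lattice0|exact: seifert_latticeD|].
    by apply: latticeMz; have [] := hP i.
  have r0 i : ell i (r x) = 0.
    rewrite ellD ellN (big_morph (ell i) (ellD b c i) (ell0 b c i)) (bigD1 i) //=.
    rewrite ellMz (hP i).2 eqxx mul1r big1 ?addr0 ?subrr // => j ji.
    by rewrite ellMz (hP j).2 eq_sym (negPf ji) mul0r.
  have [q qE] := kernel_vectorP c_gt0 bc_coprime c_coprime r0.
  have /kernel_vector_lattice[e] : Lambda (kernel_vector b c *~ q) by rewrite -qE.
  rewrite add0r => eE; have /dvdzP[p pE] : (M%:Z %| q)%Z.
    have Mr : coprimez M%:Z (chern_residue d l b c) by rewrite coprimez_sym.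
    by rewrite -(Gauss_dvdzr q Mr) eE dvdz_mull.
  by exists p; rewrite qE pE [p * _]mulrC mulrzA.
have tau1 : tau.1 != 0.
  rewrite /tau (raddfMz fst) /= mulrzz mulf_neq0 // -lt0n ?prodn_gt0 //.
pose q x := ((r x).1 %/ tau.1)%Z.
have qE x p : r x = tau *~ p -> q x = p.
  by move=> rx; rewrite /q rx (raddfMz fst) mulrzz mulKz.
apply: (free_monoid_algebra_smooth algS (h := h) (tau := tau) (e := ell) (q := q)) => //.
- exact: ellD.
- move=> x y [_ xL] [_ yL]; have [p pE] := r_tau x xL; have [p' p'E] := r_tau y yL.
  by rewrite (qE x p) // (qE y p') // (qE _ (p + p')) // rD pE p'E mulrzDr.
- by move=> i x [].
- move=> x [_ xL]; have [p pE] := r_tau x xL; rewrite (qE x p) // -pE.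
  by rewrite addrC subrK.
Qed.

End MonoidSmoothness.

(** * The equivalence *)

Theorem proposition29 (k : fieldType) (n M : nat) (d : 'I_n -> int) (l : int)
    (b c : 'I_n -> nat) :
  (0 < n)%N -> (0 < M)%N ->
  (forall p : nat, p \in [pchar k] -> ~~ (p %| M)%N) ->
  (forall i : 'I_n, \big[gcdn/M]_(j < n | j != i) `|d j|%N = 1%N) ->
  (forall i : 'I_n, (b i < c i)%N) ->
  (forall i : 'I_n, coprime (b i) (c i)) ->
  let s := fun i : 'I_n => (b i)%:R / (c i)%:R : rat in
  let C := (\prod_(i < n) c i)%N in
  let m := fun i : 'I_n => ((\prod_(j < n | j != i) c j) * b i)%N%:Z in
  [<-> smooth_Y M d (OXj k M d l) s;
       (forall i j : 'I_n, i != j -> coprime (c i) (c j)) /\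
       generates_Cl (OX k M d) (rtwist M d (OXj k M d (l * C%:Z)) 1 m);
       (forall i j : 'I_n, i != j -> coprime (c i) (c j)) /\
       (exists r : int, Cl_residue M d (rtwist M d (OXj k M d l) C%:Z m) r /\
                        coprimez r M%:Z)].
Proof.
move=> n_gt0 M_gt0 _ d_gcd lt_bc bc_coprime s C m.
have c_gt0 i : (0 < c i)%N by apply: leq_ltn_trans (lt_bc i).
pose a : {ffun 'I_n -> int} := [ffun i => - m i].
pose r := chern_residue d l b c.
have slabOX j := slab_module_tight k M_gt0 d_gcd 0 j.
have NE : rtwist M d (OXj k M d l) C%:Z m = slab_module M d a (l * C%:Z).
  by rewrite OXj_slab (rtwist_tight n_gt0 M_gt0 d_gcd _ _ (slabOX l)) mul0rz add0r.
have NE' : rtwist M d (OXj k M d (l * C%:Z)) 1 m = slab_module M d a (l * C%:Z).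
  by rewrite OXj_slab (rtwist_tight n_gt0 M_gt0 d_gcd _ _ (slabOX _)) mul0rz add0r mulr1.
have rE : r = l * C%:Z - ext_weight d a.
  by rewrite /r /chern_residue /ext_weight -sumrN; congr (_ + _); apply: eq_bigr => i _;
    rewrite ffunE mulrN opprK.
have scaleP q f : slab_module M d (a *~ q) (l * C%:Z * q) f <->
    slab_module M d 0 (r * q) (@xmon k n (- (a *~ q)) * f).
  by rewrite (slab_module_scale M d (- (a *~ q))) subrr wtN wtZ -mulrBl -rE.
have scale1 f : slab_module M d a (l * C%:Z) f <->
    slab_module M d 0 r (@xmon k n (- a) * f).
  by have := scaleP 1 f; rewrite !mulr1z !mulr1.
have rpowE q : rpow (OX k M d) (slab_module M d a (l * C%:Z)) q =
    slab_module M d (a *~ q) (l * C%:Z * q).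
  apply: (hull_tight n_gt0 M_gt0 d_gcd); apply: (mpow_tight n_gt0 M_gt0 d_gcd).
  exact: (slab_module_tight k M_gt0 d_gcd).
have algS := seifert_monoid_algebra k l b n_gt0 M_gt0 d_gcd c_gt0.
rewrite NE NE'; tfae.
- move=> [_ smB].
  have basis := smooth_facet_basis M_gt0 d_gcd c_gt0 bc_coprime algS smB.
  split; first exact: (facet_basis_coprime bc_coprime basis).
  have /coprimezP[[u v] /= uv] := facet_basis_chern n_gt0 d_gcd c_gt0 bc_coprime basis.
  split; first exact: (slab_module_reflexive k n_gt0 M_gt0 d_gcd).
  move=> P /(reflexive_slab n_gt0 M_gt0 d_gcd)[j PE]; exists (u * j).
  rewrite rpowE; have Ej : slab_module (k := k) M d 0 j = slab_module M d 0 (r * (u * j)).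
    apply: slab_module_eq; exists (v * j).
    by rewrite -{1}[j]mul1r -uv /r; ring.
  rewrite Ej in PE.
  apply: misom_scale_right PE; first exact: (@xmon_neq0 k n (a *~ (u * j))).
  move=> f; have fE : @xmon k n (- (a *~ (u * j))) * (@xmon k n (a *~ (u * j)) * f) = f.
    by rewrite mulrA -xmonD addNr xmon0 mul1r.
  by rewrite scaleP fE.
- move=> [c_coprime [_ gen]]; split=> //; exists r; split.
    rewrite /Cl_residue OXj_slab.
    exact: (misom_scale _ (@xmon_neq0 k n (- a)) scale1).
  have [q] := gen _ (slab_module_reflexive k n_gt0 M_gt0 d_gcd 0 1).
  rewrite rpowE => /(misom_scale_right (@xmon_neq0 k n (- (a *~ q))) (scaleP q)).
  move=> /(misom_slab_congr n_gt0 M_gt0 d_gcd)[p pE].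
  by apply/coprimezP; exists (q, p); rewrite /= [RHS]pE; ring.
- move=> [c_coprime [r' [+ r'M]]]; rewrite /Cl_residue OXj_slab.
  move=> /(misom_scale_left (@xmon_neq0 k n (- a)) scale1).
  move=> /(misom_slab_congr n_gt0 M_gt0 d_gcd)[p pE].
  have rM : coprimez r M.
    case/coprimezP: r'M => -[u v] /= uv; apply/coprimezP; exists (u, v - u * p).
    by rewrite /= pE -[RHS]uv; ring.
  apply: (facet_basis_smooth M_gt0 d_gcd c_gt0 bc_coprime algS n_gt0).
  exact: (coprime_facet_basis bc_coprime c_coprime rM).
Qed.
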